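(* Let $R_k$ denote either $R_k(t) := |P_k(e^{it})|^2$ for all $k$ or $R_k(t) := |Q_k(e^{it})|^2$ for all $k$, and let $n := 2^k$. For every real $\eta \in (-1/2, 1/2)$ and every $\varepsilon > 0$ there exists $k_{\eta,\varepsilon}$ such that for every integer $k \geq k_{\eta,\varepsilon}$ the equation $R_k(t) = (1+\eta)n$ has at least $(1/2 - |\eta| - \varepsilon)\, n/2$ distinct solutions $t \in K$.
   Context: The Rudin-Shapiro polynomials are defined recursively by $P_0(z) := 1$, $Q_0(z) := 1$, and for $k = 0,1,2,\ldots$: $P_{k+1}(z) := P_k(z) + z^{2^k} Q_k(z)$, $Q_{k+1}(z) := P_k(z) - z^{2^k} Q_k(z)$. Thus $P_k$ and $Q_k$ are polynomials of degree $n-1$, $n = 2^k$, with all coefficients in $\{-1,1\}$. $K := \mathbb{R} \pmod{2\pi}$, i.e. solutions are counted on one period $[0,2\pi)$. *)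

(* Defs.v *)
From Stdlib Require Import Reals List.
Open Scope R_scope.

(* Coefficient lists (coefficient of z^j at position j) of the
   Rudin-Shapiro polynomials P_k, Q_k.
   P_{k+1} = P_k + z^{2^k} Q_k, Q_{k+1} = P_k - z^{2^k} Q_k; since P_k has
   exactly 2^k coefficients, this is concatenation of coefficient lists. *)
Fixpoint RS (k : nat) : list R * list R :=
  match k with
  | O => (1 :: nil, 1 :: nil)
  | S k' => let (p, q) := RS k' in (p ++ q, p ++ map Ropp q)
  end.

Definition RS_P (k : nat) : list R := fst (RS k).
Definition RS_Q (k : nat) : list R := snd (RS k).

Fixpoint re_eval (l : list R) (j : nat) (t : R) : R :=
  match l with
  | nil => 0
  | a :: l' => a * cos (INR j * t) + re_eval l' (S j) t
  end.
Fixpoint im_eval (l : list R) (j : nat) (t : R) : R :=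
  match l with
  | nil => 0
  | a :: l' => a * sin (INR j * t) + im_eval l' (S j) t
  end.

Definition abs2_on_circle (l : list R) (t : R) : R :=
  (re_eval l 0 t) ^ 2 + (im_eval l 0 t) ^ 2.

Definition Rk (usePQ : bool) (k : nat) (t : R) : R :=
  abs2_on_circle (if usePQ then RS_P k else RS_Q k) t.

(* Main.v *)
Require Import Defs.
From Stdlib Require Import Reals List.
From mathcomp Require all_boot all_order all_algebra ring lra zify.
From mathcomp Require classical_sets boolp reals polyXY complex Rstruct.
Open Scope R_scope.

(* Write X_k = (|P_k|^2 - |Q_k|^2) / 2^(k+1) on the unit circle, so that
   R_k = n (1 + X_k) or n (1 - X_k), and let t_j = 2 pi j / n with n = 2^k.

   Oscillation. X_k(t_j) = (-1)^j X_{k-2}(t_j), and X_{k-2} is a trigonometric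
   polynomial with at most n/2 zeros on a period; hence X_k changes sign on at
   least n/2 of the intervals [t_j, t_{j+1}).  Such an interval contains a
   solution of X_k = eta unless one of its ends satisfies 0 <= X_k <= eta
   (taking eta >= 0), so it suffices to know that at most about |eta| n / 2 of
   the t_j do.

   Equidistribution of the X_k(t_j) in [-1, 1]. The form
     Gamma_k(s,t) = (s P_k + t Q_k) (t conj P_k - s conj Q_k) / 2^(k+1)
   satisfies Gamma_{k+1}(s,t) = - Gamma_k(s+t, x (s-t)) / (2 x), x = z^(2^k),
   and the middle coefficient of Gamma_k^d is the d-th Legendre polynomial
   of X_k.  The average of Gamma_k^d over the z with z^(2^k) = w is
   sum_{f,m} a_k(f,m) w^(f-d) s^(N-m) t^m with N = 2d, where a_{k+1} arises
   from a_k by keeping the entries with f + m even, moved to row (f+m)/2, and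
   applying to each row the Krawtchouk matrix, an isometry up to scale.  The
   energy of a_k therefore drops by that of the entries with f + m odd, so
   those tend to 0.  Rows are then handled by downward induction: in the limit
   row F is the coefficient vector of a polynomial of degree at most F
   divisible by (1-X)^F whose coefficient of degree F-1 vanishes, that is, 0.
   Hence the Legendre averages tend to 0, and Bernstein polynomials turn this
   into the upper bound for the number of t_j in an interval. *)

Module RudinShapiroLevels.

Import all_boot all_order all_algebra ring lra zify.
Import classical_sets boolp reals polyXY complex Rstruct.
Set Implicit Arguments.
Unset Strict Implicit.
Unset Printing Implicit Defensive.
Import Order.TTheory GRing.Theory Num.Theory.
Local Open Scope ring_scope.

(** * Sequences tending to zero *)

Section NullSequences.
Variable R : realFieldType.
Implicit Types u v : nat -> R.

Definition null u :=
  forall e, 0 < e -> exists K, forall k, (K <= k)%N -> `|u k| < e.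

Lemma eq_null u v : u =1 v -> null u -> null v.
Proof. by move=> uv h e /h [K hK]; exists K => k /hK; rewrite uv. Qed.

Lemma null0 : null (fun=> 0).
Proof. by move=> e e0; exists 0%N => k _; rewrite normr0. Qed.

Lemma nullD u v : null u -> null v -> null (fun k => u k + v k).
Proof.
move=> hu hv e e0; have e2 : 0 < e / 2 by rewrite divr_gt0.
have [K hK] := hu _ e2; have [L hL] := hv _ e2.
exists (maxn K L) => k; rewrite geq_max => /andP[/hK h1 /hL h2].
by rewrite (le_lt_trans (ler_normD _ _))// [e]splitr ltrD.
Qed.

Lemma nullZ c u : null u -> null (fun k => c * u k).
Proof.
move=> hu e e0; have c0 : 0 < `|c| + 1 by rewrite ltr_wpDl.
have [K hK] := hu _ (divr_gt0 e0 c0).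
exists K => k /hK; rewrite ltr_pdivlMr// => h; rewrite normrM.
by apply: le_lt_trans h; rewrite mulrC ler_wpM2l// lerDl.
Qed.

Lemma null_sum (I : Type) (r : seq I) (P : pred I) (F : I -> nat -> R) :
  (forall i, P i -> null (F i)) -> null (fun k => \sum_(i <- r | P i) F i k).
Proof.
move=> h; elim: r => [|i r IH].
  by apply: eq_null null0 => k; rewrite big_nil.
case: (boolP (P i)) => Pi.
  by apply: eq_null (nullD (h i Pi) IH) => k; rewrite big_cons Pi.
by apply: eq_null IH => k; rewrite big_cons (negPf Pi).
Qed.

Lemma null_shift u : null (fun k => u k.+1) <-> null u.
Proof.
split=> h e /h [K hK]; last by exists K => k Kk; apply: hK; rewrite ltnW.
by exists K.+1 => -[//|k] /hK.
Qed.

Lemma null_le u v : (forall k, `|u k| <= v k) -> null v -> null u.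
Proof.
move=> uv h e /h [K hK]; exists K => k /hK; apply: le_lt_trans.
by rewrite (le_trans (uv k))// ler_norm.
Qed.

Lemma null_sqr u : null (fun k => u k ^+ 2) -> null u.
Proof.
move=> h e e0; have [K hK] := h _ (exprn_gt0 2 e0).
by exists K => k /hK; rewrite normrX ltr_pXn2r// nnegrE// ltW.
Qed.

(** Injectivity passes to the limit: [pinvmx M] is a right inverse of [M], so the entries of [v k]
    are fixed linear combinations of those of [v k *m M]. *)
Lemma null_row_free m n (M : 'M[R]_(m, n)) (v : nat -> 'rV[R]_m) :
  row_free M -> (forall j, null (fun k => (v k *m M) 0 j)) ->
  forall i, null (fun k => v k 0 i).
Proof.
move=> fM h i.
apply: (@eq_null (fun k => \sum_j (v k *m M) 0 j * pinvmx M j i)) => [k|].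
  by rewrite -[in RHS](mulmxKp fM (v k)) mxE.
apply: null_sum => j _.
by apply: eq_null (nullZ (pinvmx M j i) (h j)) => k; rewrite mulrC.
Qed.

End NullSequences.

(** The terms decrease to their infimum, so consecutive ones eventually differ by less than [e]. *)
Lemma null_decrement (R : realType) (E : nat -> R) :
  (forall k, 0 <= E k) -> (forall k, E k.+1 <= E k) ->
  null (fun k => E k - E k.+1).
Proof.
move=> E0 dE e e0.
have hE : has_inf (range E).
  by split; [exists (E 0%N), 0%N | exists 0 => _ [k _ <-]].
have [_ [K _ <-] hK] := inf_adherent e0 hE.
exists K => k Kk.
have le1 : E k <= E K.
  elim: k Kk => [|k IH]; first by rewrite leqn0 => /eqP->.
  by rewrite leq_eqVlt => /predU1P[->//|/IH]; apply: le_trans.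
have le2 : inf (range E) <= E k.+1 by apply: ge_inf; [case: hE | exists k.+1].
by rewrite ger0_norm ?subr_ge0//; lra.
Qed.

(** * Krawtchouk matrices *)

Section Krawtchouk.

(** The matrix of the substitution (s, t) -> (s + t, s - t) on binary forms of degree [N], in the
    basis s^(N-j) t^j. *)
Definition krawtchouk (A : comNzRingType) N : 'M[A]_N.+1 :=
  \matrix_(i, j) ((1 + 'X) ^+ (N - i) * (1 - 'X) ^+ i : {poly A})`_j.

Section Hom.
Variables (A B : comNzRingType) (phi : {rmorphism A -> B}).

(** Homogenisation of [f] in degree [n]. The separate target ring lets [s] and [t] be polynomials or
    complex numbers while the coefficients stay in [A]. *)
Definition homog_eval n (f : {poly A}) (s t : B) : B :=
  \sum_(j < n.+1) phi f`_j * (s ^+ (n - j) * t ^+ j).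

Lemma homog_eval_mul_linear n (f : {poly A}) a b s t : (size f <= n.+1)%N ->
  homog_eval n.+1 (f * (a%:P + b *: 'X)) s t = homog_eval n f s t * (phi a * s + phi b * t).
Proof.
move=> sf; rewrite /homog_eval [RHS]mulrDr !mulr_suml.
have -> : \sum_(j < n.+1) phi f`_j * (s ^+ (n - j) * t ^+ j) * (phi a * s) =
    \sum_(j < n.+2) phi (f * a%:P)`_j * (s ^+ (n.+1 - j) * t ^+ j).
  rewrite [RHS]big_ord_recr/= coefMC nth_default// mul0r rmorph0 mul0r addr0.
  apply: eq_bigr => j _; rewrite coefMC rmorphM subSn ?leq_ord// exprS; ring.
have -> : \sum_(j < n.+1) phi f`_j * (s ^+ (n - j) * t ^+ j) * (phi b * t) =
    \sum_(j < n.+2) phi (f * (b *: 'X))`_j * (s ^+ (n.+1 - j) * t ^+ j).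
  rewrite [RHS]big_ord_recl/= -scalerAr coefZ coefMX/= mulr0 rmorph0 mul0r add0r.
  apply: eq_bigr => j _; rewrite coefZ coefMX/= rmorphM subSS exprS; ring.
rewrite -big_split/=; apply: eq_bigr => j _.
by rewrite -mulrDl -rmorphD -coefD -mulrDr.
Qed.

Lemma homog_eval_krawtchouk a b s t :
  homog_eval (a + b) ((1 + 'X) ^+ a * (1 - 'X) ^+ b) s t = (s + t) ^+ a * (s - t) ^+ b.
Proof.
have sz c n (f : {poly A}) :
    (size f <= n.+1)%N -> (size (f * (1 + c *: 'X))%R <= n.+2)%N.
  move=> sf; rewrite (leq_trans (size_polyMleq _ _))//.
  have s2 : (size (1 + c *: 'X : {poly A})%R <= 2)%N.
    rewrite (leq_trans (size_polyD _ _))// geq_max size_poly1/=.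
    by rewrite (leq_trans (size_scale_leq _ _))// size_polyX.
  by move: (size f) (size (1 + c *: 'X)%R) sf s2 => *; lia.
have -> : (1 + 'X : {poly A}) = 1 + 1 *: 'X by rewrite scale1r.
have -> : (1 - 'X : {poly A}) = 1 + (-1) *: 'X by rewrite scaleN1r.
(* Linear factors are added one at a time; the size bound accompanies the induction because
   [homog_eval] truncates at degree [n]. *)
suff [] : homog_eval (a + b) ((1 + 1 *: 'X) ^+ a * (1 + (-1) *: 'X) ^+ b) s t =
    (s + t) ^+ a * (s - t) ^+ b /\
    (size ((1 + 1 *: 'X) ^+ a * (1 + (-1) *: 'X) ^+ b : {poly A})%R
       <= (a + b).+1)%N by [].
elim: b => [|b [IH1 IH2]].
  rewrite addn0 !expr0 !mulr1; elim: a => [|a [IH1 IH2]].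
    rewrite !expr0 size_poly1 /homog_eval big_ord1 coef1/= rmorph1.
    by rewrite subnn !expr0 !mulr1.
  rewrite exprSr; split; last exact: sz.
  by rewrite homog_eval_mul_linear// IH1 rmorph1 !mul1r -exprSr.
rewrite addnS exprSr mulrA; split; last exact: sz.
by rewrite homog_eval_mul_linear// IH1 rmorph1 rmorphN1 mul1r mulN1r -mulrA -exprSr.
Qed.

Lemma krawtchouk_homog N (i : 'I_N.+1) s t :
  \sum_j phi (krawtchouk A N i j) * (s ^+ (N - j) * t ^+ j) =
    (s + t) ^+ (N - i) * (s - t) ^+ i.
Proof.
rewrite -homog_eval_krawtchouk subnK ?leq_ord// /homog_eval.
by apply: eq_bigr => j _; rewrite mxE.
Qed.

End Hom.

Lemma krawtchouk_row_poly (A : comNzRingType) N (i : 'I_N.+1) :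
  (1 + 'X) ^+ (N - i) * (1 - 'X) ^+ i = \sum_j krawtchouk A N i j *: 'X^j.
Proof.
rewrite -(krawtchouk_homog (polyC : {rmorphism A -> {poly A}}) i 1 'X).
by apply: eq_bigr => j _; rewrite expr1n mul1r mul_polyC.
Qed.

(** Substituting twice sends (s, t) to (2s, 2t). The proof takes s = 1 + X, t = 1 - X and compares
    coefficients. *)
Lemma krawtchouk_mul (A : comNzRingType) N : krawtchouk A N *m krawtchouk A N = (2 ^+ N)%:M.
Proof.
apply/matrixP => i l; rewrite !mxE.
have := krawtchouk_homog (polyC : {rmorphism A -> {poly A}}) i (1 + 'X) (1 - 'X).
have -> : (1 + 'X + (1 - 'X)) = 2%:P :> {poly A} by rewrite polyC_natr; ring.
have -> : (1 + 'X - (1 - 'X)) = 2%:P * 'X :> {poly A} by rewrite polyC_natr; ring.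
rewrite exprMn mulrA -exprD subnK ?leq_ord// -polyC_exp => /(congr1 (fun p : {poly A} => p`_l)).
rewrite coefCM coefXn coef_sum eq_sym mulr_natr -val_eqE/= => <-.
by apply: eq_bigr => j _; rewrite coefCM !mxE.
Qed.

(* Both sides are the coefficient of [w^i y^j] in [(1 + y + w - w y)^N]. *)
Lemma krawtchouk_sym (A : comNzRingType) N (i j : 'I_N.+1) :
  'C(N, i)%:R * krawtchouk A N i j = 'C(N, j)%:R * krawtchouk A N j i.
Proof.
pose G : {poly {poly A}} := ((1 + 'X)%:P + (1 - 'X)%:P * 'X) ^+ N.
have GE (k : 'I_N.+1) : G`_k = 'C(N, k)%:R * ((1 + 'X) ^+ (N - k) * (1 - 'X) ^+ k).
  rewrite /G exprDn coef_sum (bigD1 k)//= big1 ?addr0 => [|l].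
    by rewrite exprMn mulrA -!polyC_exp coefMn coefMXn ltnn subnn -polyCM coefC eqxx mulr_natl.
  rewrite -val_eqE => /negPf lk.
  rewrite exprMn mulrA -!polyC_exp -polyCM coefMn coefCM coefXn eq_sym lk.
  by rewrite mulr0 mul0rn.
have GS : swapXY G = G.
  rewrite /G !(polyCD, polyCN) polyC1 rmorphXn rmorphD rmorphM.
  rewrite !rmorphD !rmorphN !rmorph1/= swapXY_X swapXY_Y.
  by congr (_ ^+ N); ring.
have cE (k l : 'I_N.+1) : G`_k`_l = 'C(N, k)%:R * krawtchouk A N k l.
  by rewrite GE mxE -polyC_natr coefCM.
by rewrite -!cE -[in LHS]GS coef_swapXY.
Qed.

End Krawtchouk.

Lemma coef_expDZX (A : comNzRingType) (a c : A) n j :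
  ((a%:P + c *: 'X) ^+ n)`_j = a ^+ (n - j) * c ^+ j * 'C(n, j)%:R.
Proof.
rewrite exprDn coef_sum.
under eq_bigr => i _ do rewrite exprZn -polyC_exp mul_polyC coefMn !coefZ coefXn.
have [jn|nj] := leqP j n.
  rewrite (bigD1 (Ordinal (jn : j < n.+1)%N))//= big1 ?addr0 => [|i].
    by rewrite eqxx mulr1 mulr_natr.
  by rewrite -val_eqE/= eq_sym => /negPf->; rewrite !mulr0 mul0rn.
rewrite bin_small// mulr0 big1// => i _.
by rewrite gtn_eqF ?mulr0 ?mul0rn// (leq_trans (ltn_ord i)).
Qed.

(** * The transfer operator and its energy *)

Section Transfer.
Variable R : realType.

(** The sum has at most one term, [g = 2 f - m], and is empty when that index is out of range. *)
Definition fold_even N (a : 'M[R]_N.+1) : 'M[R]_N.+1 :=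
  \matrix_(f, m) \sum_(g < N.+1 | (g + m)%N == f.*2) a g m.

Lemma fold_evenE N (a : 'M[R]_N.+1) (f g m : 'I_N.+1) :
  (g + m)%N = f.*2 -> fold_even a f m = a g m.
Proof.
move=> e; rewrite mxE (big_pred1 g)// => h /=.
by rewrite -e eqn_add2r.
Qed.

(** The d-th power of the constant -1/2 in [gamma_formS]. *)
Definition scale_factor d : R := (- 2^-1) ^+ d.

Definition transfer d (a : 'M[R]_(d.*2.+1)) : 'M[R]_(d.*2.+1) :=
  scale_factor d *: (fold_even a *m krawtchouk R d.*2).

Lemma scale_factor_sqr d : scale_factor d * scale_factor d * 2 ^+ d.*2 = 1.
Proof.
rewrite /scale_factor -exprMn -mul2n exprM -exprMn.
by rewrite (_ : - 2^-1 * - 2^-1 * 2 ^+ 2 = 1 :> R) ?expr1n//; field.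
Qed.

(** The scaled Krawtchouk matrix is its own inverse, so the folded state can be read back from the
    next state. *)
Lemma fold_transfer d (a : 'M[R]_(d.*2.+1)) :
  fold_even a = scale_factor d *: (transfer a *m krawtchouk R d.*2).
Proof.
rewrite /transfer -scalemxAl -mulmxA krawtchouk_mul mul_mx_scalar !scalerA.
by rewrite scale_factor_sqr scale1r.
Qed.

(** With these weights [energy] sums the squared Bombieri norms of the rows, seen as binary forms;
    the Krawtchouk substitution preserves that norm up to scale. *)
Definition weight N : 'M[R]_N.+1 := diag_mx (\row_m ('C(N, m)%:R)^-1).

Definition energy N (a : 'M[R]_N.+1) := \tr (a *m weight N *m a^T).

Lemma energyE N (a : 'M[R]_N.+1) :
  energy a = \sum_(m < N.+1) \sum_(f < N.+1) ('C(N, m)%:R)^-1 * a f m ^+ 2.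
Proof.
rewrite /energy /mxtrace exchange_big/=; apply: eq_bigr => f _.
rewrite mxE; apply: eq_bigr => m _.
by rewrite /weight mul_mx_diag !mxE; ring.
Qed.

Lemma binV_gt0 N (m : 'I_N.+1) : 0 < ('C(N, m)%:R)^-1 :> R.
Proof. by rewrite invr_gt0 ltr0n bin_gt0 leq_ord. Qed.

(** By [krawtchouk_sym], K W = W K^T; hence K W K^T = W (K K)^T = 2^N W, and the square of
    [scale_factor] cancels 2^N. *)
Lemma energy_transfer d (a : 'M[R]_(d.*2.+1)) : energy (transfer a) = energy (fold_even a).
Proof.
set N := d.*2.
have KW : krawtchouk R N *m weight N = weight N *m (krawtchouk R N)^T.
  rewrite /weight mul_mx_diag mul_diag_mx; apply/matrixP => i j.
  have := krawtchouk_sym R i j; rewrite !mxE => h.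
  have bi := binV_gt0 i; have bj := binV_gt0 j.
  have ci : 'C(N, i)%:R != 0 :> R by rewrite -invr_eq0 gt_eqF.
  have cj : 'C(N, j)%:R != 0 :> R by rewrite -invr_eq0 gt_eqF.
  by apply: (mulfI ci); rewrite mulrA h; field; apply/andP.
rewrite /energy /transfer linearZ/= trmx_mul -!scalemxAl -scalemxAr scalerA.
rewrite -!mulmxA (mulmxA (krawtchouk R N)) KW -(mulmxA (weight N)) (mulmxA _^T _^T).
rewrite -trmx_mul krawtchouk_mul tr_scalar_mx mul_scalar_mx -!scalemxAr scalerA.
by rewrite scale_factor_sqr scale1r.
Qed.

Lemma energy_ge0 N (a : 'M[R]_N.+1) : 0 <= energy a.
Proof.
rewrite energyE; apply: sumr_ge0 => m _; apply: sumr_ge0 => f _.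
by rewrite mulr_ge0 ?sqr_ge0// ltW ?binV_gt0.
Qed.

(** Folding moves the entries with f + m even injectively within their column, where the weight is
    constant, and discards the others. *)
Lemma energy_fold N (a : 'M[R]_N.+1) :
  energy a - energy (fold_even a) =
    \sum_(m < N.+1) \sum_(f < N.+1 | odd (f + m)) ('C(N, m)%:R)^-1 * a f m ^+ 2.
Proof.
rewrite !energyE -sumrB; apply: eq_bigr => m _.
rewrite (bigID (fun f : 'I_N.+1 => odd (f + m))) /= -addrA.
rewrite [X in _ + X](_ : _ = 0) ?addr0//; apply/eqP; rewrite subr_eq0; apply/eqP.
rewrite (partition_big (fun f : 'I_N.+1 => inord (f + m)./2 : 'I_N.+1) xpredT)//=.
apply: eq_bigr => f _.
have E (g : 'I_N.+1) : (~~ odd (g + m) && (inord (g + m)./2 == f)) =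
    ((g + m)%N == f.*2).
  have gN := leq_ord g; have mN := leq_ord m.
  rewrite -val_eqE/= inordK; last by lia.
  by apply/idP/idP; lia.
rewrite (eq_bigl _ _ E); case: (pickP (fun g : 'I_N.+1 => (g + m)%N == f.*2)) => [g /eqP eg|h].
  rewrite (fold_evenE a eg) (big_pred1 g)// => h /=.
  by rewrite -eg eqn_add2r.
by rewrite mxE !big_pred0// expr0n mulr0.
Qed.

Lemma coef_exp1DZX (c : R) n j : ((1 + c *: 'X) ^+ n)`_j = c ^+ j * 'C(n, j)%:R.
Proof. by rewrite -polyC1 coef_expDZX expr1n mul1r. Qed.

(* The polynomial with coefficients [v *m K] is divisible by [(1 - X)^F] and of
   degree at most [F], hence a multiple of [(1 - X)^F]; its coefficient of
   degree [F - 1] vanishes, so it is zero. *)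
Lemma krawtchouk_support N (v : 'rV[R]_N.+1) (F : nat) :
  (0 < N)%N ->
  (forall m : 'I_N.+1, (m < F)%N || ((F == 0%N) && (0 < m)%N) -> v 0 m = 0) ->
  (forall m : 'I_N.+1, (F < m)%N || (m.+1 == F) -> (v *m krawtchouk R N) 0 m = 0) ->
  v = 0.
Proof.
move=> N0 hv hK.
pose p : {poly R} := \sum_(m < N.+1) v 0 m *: ((1 + 'X) ^+ (N - m) * (1 - 'X) ^+ m).
have pE (j : 'I_N.+1) : p`_j = (v *m krawtchouk R N) 0 j.
  by rewrite coef_sum mxE; apply: eq_bigr => m _; rewrite coefZ mxE.
have pbig j : (N < j)%N -> p`_j = 0.
  move=> Nj; rewrite coef_sum big1// => m _; rewrite krawtchouk_row_poly coefZ coef_sum.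
  rewrite big1 ?mulr0// => l _; rewrite coefZ coefXn gtn_eqF ?mulr0//.
  by rewrite (leq_ltn_trans (leq_ord l)).
suff p0 : p = 0.
  have vK : v *m krawtchouk R N = 0.
    by apply/rowP => j; rewrite -pE p0 coef0 mxE.
  have := congr1 (mulmx^~ (krawtchouk R N)) vK.
  rewrite -mulmxA krawtchouk_mul mul_mx_scalar mul0mx => /eqP.
  by rewrite scaler_eq0 expf_eq0 pnatr_eq0 andbF => /eqP.
(* For F = 0 there is no degree F - 1. Only the entry [v 0 ord0] survives, so [p] is a multiple of
   (1 + X)^N, and its linear coefficient vanishes. *)
have [F0|F1] := posnP F.
  have v0 (m : 'I_N.+1) : m != ord0 -> v 0 m = 0.
    by rewrite -val_eqE/= => m0; apply: hv; rewrite F0/= lt0n.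
  have pv : p = v 0 ord0 *: (1 + 'X) ^+ N.
    rewrite /p (bigD1 ord0)//= big1 ?addr0; last first.
      by move=> m m0; rewrite v0// scale0r.
    by rewrite expr0 mulr1 subn0.
  have /eqP : (v *m krawtchouk R N) 0 (Ordinal (N0 : 1 < N.+1)%N) = 0 by apply: hK; rewrite F0.
  rewrite -pE/= pv coefZ -['X]scale1r coef_exp1DZX bin1 mul1r mulf_eq0.
  by rewrite pnatr_eq0 (gtn_eqF N0) orbF => /eqP->; rewrite scale0r.
pose q : {poly R} :=
  \sum_(m < N.+1) v 0 m *: ((1 + 'X) ^+ (N - m) * (1 - 'X) ^+ (m - F)).
have pq : p = q * (1 - 'X) ^+ F.
  rewrite /p /q mulr_suml; apply: eq_bigr => m _; rewrite -scalerAl -mulrA -exprD.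
  have [Fm|mF] := leqP F m; first by rewrite subnK.
  by rewrite hv ?mF// !scale0r.
have sp : (size p <= F.+1)%N.
  apply/leq_sizeP => j Fj; have [Nj|jN] := ltnP N j; first exact: pbig.
  by have := pE (Ordinal (jN : j < N.+1)%N) => /= ->; rewrite hK//= Fj.
have [q0|q0] := eqVneq q 0; first by rewrite pq q0 mul0r.
have qc : q = (q`_0)%:P.
  apply: size1_polyC; move: sp; rewrite pq.
  have -> : (1 - 'X) = - ('X - 1%:P) :> {poly R} by rewrite opprB.
  rewrite exprNn mulrCA -signr_odd mulr_sign (fun_if (fun r : {poly R} => size r)) size_polyN if_same.
  by rewrite size_Mmonic ?monic_exp ?monicXsubC// size_exp_XsubC addnS/= -addn1 addnC leq_add2l.
have [FN|NF] := leqP F N.+1; last first.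
  have v0 : v = 0 by apply/rowP => m; rewrite mxE hv// (ltn_trans (ltn_ord m) NF).
  by rewrite /p big1// => m _; rewrite v0 mxE scale0r.
have F1N : (F.-1 < N.+1)%N by rewrite prednK.
have := pE (Ordinal F1N); rewrite hK/= ?prednK ?eqxx ?orbT//.
rewrite pq qc coefCM -scaleN1r coef_exp1DZX => /eqP.
rewrite !mulf_eq0 signr_eq0 pnatr_eq0 -bin_sub ?leq_pred//.
rewrite (_ : F - F.-1 = 1)%N ?bin1; last by lia.
by rewrite (gtn_eqF F1) !orbF => /eqP->; rewrite mul0r.
Qed.

(** Row F of the next state is, up to scale, [b k *m krawtchouk R N]. Both vanishing conditions of
    [krawtchouk_support] hold for [b k] in the limit, so [null_row_free] makes [b k] tend to 0. *)
Lemma transfer_null d (a : 'M[R]_(d.*2.+1)) : (0 < d)%N ->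
  forall f m, null (fun k => iter k (@transfer d) a f m).
Proof.
move=> d0; set N := d.*2; pose A k := iter k (@transfer d) a.
have N0 : (0 < N)%N by rewrite double_gt0.
(* The weighted square of such an entry is at most the energy lost in one step. *)
have A_odd (f m : 'I_N.+1) : odd (f + m) -> null (fun k => A k f m).
  move=> fm; apply: null_sqr.
  pose w : R := ('C(N, m)%:R)^-1.
  apply: (@null_le _ _ (fun k => w^-1 * (energy (A k) - energy (A k.+1)))).
    move=> k; rewrite ger0_norm ?sqr_ge0// ler_pdivlMl ?binV_gt0//.
    rewrite /A iterS energy_transfer energy_fold (bigD1 m)//= (bigD1 f)//= -addrA lerDl.
    rewrite addr_ge0// ?sumr_ge0// => [g _|j _].
      by rewrite mulr_ge0 ?sqr_ge0// ltW ?binV_gt0.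
    by rewrite sumr_ge0// => g _; rewrite mulr_ge0 ?sqr_ge0// ltW ?binV_gt0.
  apply: nullZ; apply: null_decrement => k; first exact: energy_ge0.
  rewrite /A iterS energy_transfer -subr_ge0 energy_fold.
  rewrite sumr_ge0// => j _; rewrite sumr_ge0// => g _.
  by rewrite mulr_ge0 ?sqr_ge0// ltW ?binV_gt0.
suff rows n (f : 'I_N.+1) : (N - f < n)%N -> forall m, null (fun k => A k f m).
  by move=> f m; exact: (rows (N - f).+1 f (leqnn _) m).
elim: n f => // n IH F FN.
have up (f : 'I_N.+1) : (F < f)%N -> forall m, null (fun k => A k f m).
  by move=> Ff; apply: IH; have := leq_ord f; lia.
pose b k := row F (fold_even (A k)).
have AS k m : A k.+1 F m = scale_factor d * (b k *m krawtchouk R N) 0 m.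
  by rewrite -row_mul [X in _ * X]mxE /A iterS [LHS]mxE.
have c0 : scale_factor d != 0 by rewrite expf_neq0// oppr_eq0 invr_eq0 pnatr_eq0.
(* [S1] marks the entries of [b k] taken from rows above F, or from no row at all when F = 0; [S2]
   marks the entries of row F that tend to 0 by [A_odd] or through higher rows. *)
pose S1 (m : 'I_N.+1) := (m < F)%N || ((F == ord0) && (0 < m)%N).
pose S2 (m : 'I_N.+1) := (F < m)%N || (m.+1 == F).
pose msk (S : pred 'I_N.+1) : 'M[R]_N.+1 := diag_mx (\row_m (S m)%:R).
have fr : row_free (row_mx (msk S1) (krawtchouk R N *m msk S2)).
  apply: inj_row_free => v; rewrite mul_mx_row mulmxA => /eqP.
  rewrite row_mx_eq0 => /andP[/eqP v1 /eqP v2].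
  apply: (@krawtchouk_support _ _ F) => // m hm.
    by have /rowP/(_ m) := v1; rewrite mul_mx_diag !mxE (_ : S1 m) ?mulr1.
  by have /rowP/(_ m) := v2; rewrite mul_mx_diag !mxE (_ : S2 m) ?mulr1.
have bnull : forall m, null (fun k => b k 0 m).
  apply: (null_row_free fr) => j.
  rewrite -[j]splitK; case: (fintype.split j) => m /=.
    apply: (@eq_null _ (fun k => (S1 m)%:R * b k 0 m)) => [k|].
      by rewrite mul_mx_row row_mxEl mul_mx_diag !mxE mulrC.
    case: (boolP (S1 m)) => hm; last first.
      by apply: eq_null (@null0 R) => k; rewrite mul0r.
    apply: nullZ; apply: (@eq_null _ (fun k => \sum_(g < N.+1 | (g + m)%N == F.*2) A k g m)).
      by move=> k; rewrite !mxE.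
    apply: null_sum => g /eqP gm; apply: up; move: hm; rewrite /S1 -val_eqE/=; lia.
  apply: (@eq_null _ (fun k => (S2 m)%:R * (scale_factor d)^-1 * A k.+1 F m)) => [k|].
    rewrite AS mulrA mulfVK// mul_mx_row mulmxA row_mxEr mul_mx_diag !mxE.
    by rewrite mulrC.
  case: (boolP (S2 m)) => hm; last first.
    by apply: eq_null (@null0 R) => k; rewrite !mul0r.
  apply: nullZ; apply/(null_shift (fun k => A k F m)).
  case: (boolP (odd (F + m))) => [|ev]; first exact: A_odd.
  (* With F + m even and m > F, folding moves the entry to row (F + m)/2 > F, which [fold_transfer]
     expresses by that row of the next state. *)
  have Fm : (F < m)%N by move: hm; rewrite /S2; lia.
  have gN : ((F + m)./2 < N.+1)%N.
    by have := leq_ord F; have := leq_ord m; lia.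
  pose g := Ordinal gN.
  apply: (@eq_null _ (fun k => \sum_i scale_factor d * krawtchouk R N i m * A k.+1 g i)).
    move=> k; rewrite -(@fold_evenE _ (A k) g F m); last by rewrite /= even_halfK.
    rewrite fold_transfer !mxE mulr_sumr; apply: eq_bigr => i _.
    by rewrite /A iterS; ring.
  apply: null_sum => i _; apply: nullZ; apply/(null_shift (fun k => A k g i)).
  by apply: up => /=; lia.
move=> m; apply/null_shift.
apply: (@eq_null _ (fun k => \sum_i scale_factor d * krawtchouk R N i m * b k 0 i)).
  by move=> k; rewrite AS mxE mulr_sumr; apply: eq_bigr => i _; ring.
by apply: null_sum => i _; apply: nullZ.
Qed.

End Transfer.

(** * Integration over [0, 1], Bernstein and Legendre polynomials *)

Section Moments.
Variable R : realType.
Implicit Types f g : {poly R}.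

Definition integral01 f : R := \sum_(i < size f) f`_i / i.+1%:R.

Lemma integral01E n f : (size f <= n)%N -> integral01 f = \sum_(i < n) f`_i / i.+1%:R.
Proof.
move=> sf; rewrite /integral01 (big_ord_widen _ (fun i => f`_i / i.+1%:R) sf) big_mkcond.
apply: eq_bigr => i _; case: ltnP => // h.
by rewrite nth_default// mul0r.
Qed.

Lemma integral01D f g : integral01 (f + g) = integral01 f + integral01 g.
Proof.
pose n := maxn (size f) (size g).
rewrite !(@integral01E n) ?leq_maxl ?leq_maxr ?size_polyD// -big_split/=.
by apply: eq_bigr => i _; rewrite coefD mulrDl.
Qed.

Lemma integral01Z c f : integral01 (c *: f) = c * integral01 f.
Proof.
rewrite !(@integral01E (size f)) ?size_scale_leq// mulr_sumr.
by apply: eq_bigr => i _; rewrite coefZ mulrA.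
Qed.

Lemma integral01_sum (I : Type) (r : seq I) (P : pred I) (F : I -> {poly R}) :
  integral01 (\sum_(i <- r | P i) F i) = \sum_(i <- r | P i) integral01 (F i).
Proof.
apply: (big_morph integral01 integral01D).
by rewrite /integral01 size_poly0 big_ord0.
Qed.

Lemma integral01_1 : integral01 1 = 1.
Proof. by rewrite /integral01 size_poly1 big_ord1 coef1 divr1. Qed.

Lemma integral01_deriv f : integral01 f^`() = f.[1] - f.[0].
Proof.
have sd : (size f^`() <= size f)%N by rewrite (leq_trans (size_poly _ _)) ?leq_pred.
rewrite (integral01E sd) (@horner_coef_wide _ (size f).+1 f 1)//.
rewrite big_ord_recl horner_coef0 expr0 mulr1 addrC addKr.
apply: eq_bigr => i _; rewrite coef_deriv expr1n mulr1 -[X in X / _]mulr_natr mulfK//.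
by rewrite pnatr_eq0.
Qed.

Definition bernstein N i : {poly R} := 'C(N, i)%:R *: ('X ^+ i * (1 - 'X) ^+ (N - i)).

Lemma sum_bernstein N : \sum_(i < N.+1) bernstein N i = 1.
Proof.
have <- : ((1 - 'X) + 'X) ^+ N = 1 :> {poly R} by rewrite subrK expr1n.
rewrite exprDn; apply: eq_bigr => i _.
by rewrite /bernstein scaler_nat mulrC.
Qed.

Lemma deriv_bernstein N i : (i < N)%N ->
  (bernstein N.+1 i.+1)^`() = N.+1%:R *: (bernstein N i - bernstein N i.+1).
Proof.
move=> iN; rewrite /bernstein subSS.
have iN1 : (N - i = (N - i.+1).+1)%N by rewrite subnSK.
have e1 : 'C(N.+1, i.+1)%:R * i.+1%:R = N.+1%:R * 'C(N, i)%:R :> {poly R}.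
  by rewrite -!natrM (mul_bin_diag N.+1 i) mulnC.
have e2 : 'C(N.+1, i.+1)%:R * (N - i)%:R = N.+1%:R * 'C(N, i.+1)%:R :> {poly R}.
  by rewrite -!natrM mulnC -subSS -mul_bin_down.
rewrite -!mul_polyC !polyC_natr derivM derivM !derivCE sub0r /=.
rewrite mul0rn mul0r add0r -['X^i *+ _]mulr_natr -[X in _ + _ * X]mulr_natr.
rewrite [X in X.-1]iN1 /= mulrBr !mulrA -e1 -e2; ring.
Qed.

(** The derivative of an inner Bernstein polynomial of degree N + 1 integrates to 0, so neighbours
    of degree N have equal integrals; all N + 1 of them sum to 1. *)
Lemma integral01_bernstein N i : (i <= N)%N -> integral01 (bernstein N i) = N.+1%:R^-1.
Proof.
have lamS j : (j < N)%N -> integral01 (bernstein N j.+1) = integral01 (bernstein N j).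
  move=> jN; apply/eqP; rewrite eq_sym -subr_eq0 -mulN1r -integral01Z -integral01D scaleN1r.
  have : integral01 (bernstein N.+1 j.+1)^`() = 0.
    rewrite integral01_deriv /bernstein subSS !hornerE subrr !expr0n/= subn_eq0 leqNgt jN/=.
    by rewrite !(mul0r, mulr0, subrr).
  rewrite deriv_bernstein// integral01Z => /eqP; rewrite mulf_eq0 pnatr_eq0 /=.
  by [].
have lam0 j : (j <= N)%N -> integral01 (bernstein N j) = integral01 (bernstein N 0).
  by elim: j => // j IH jN; rewrite lamS// IH// ltnW.
move=> iN; rewrite lam0//.
have := integral01_1; rewrite -(sum_bernstein N) integral01_sum.
under eq_bigr => j _ do rewrite lam0 ?leq_ord//.
rewrite sumr_const card_ord => h.
have n0 : N.+1%:R != 0 :> R by rewrite pnatr_eq0.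
by apply: (mulIf n0); rewrite mulr_natr h mulVf.
Qed.

(** The Legendre polynomial shifted to [0, 1], in the form in which [coef_gamma_poly] produces
    it. *)
Definition legendre d : {poly R} :=
  \sum_(i < d.+1) ('C(d, i) ^ 2)%:R *: ('X ^+ (d - i) * ('X - 1) ^+ i).

(** Each term is a signed binomial multiple of a Bernstein polynomial, so the integral is (1 - 1)^d
    / (d + 1). *)
Lemma integral01_legendre d : (0 < d)%N -> integral01 (legendre d) = 0.
Proof.
move=> d0; rewrite /legendre integral01_sum.
have E (i : 'I_d.+1) :
    integral01 (('C(d, i) ^ 2)%:R *: ('X ^+ (d - i) * ('X - 1) ^+ i)) =
    d.+1%:R^-1 * ((1 ^+ (d - i) * (-1) ^+ i) *+ 'C(d, i)).
  have -> : ('X - 1) = - (1 - 'X) :> {poly R} by rewrite opprB.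
  rewrite -(@integral01_bernstein d (d - i)) ?leq_subr// /bernstein subKn ?leq_ord//.
  rewrite bin_sub ?leq_ord// [(- (1 - 'X)) ^+ i]exprNn expr1n mul1r !integral01Z.
  have -> : (-1) ^+ i = ((-1) ^+ i)%:P :> {poly R} by rewrite rmorphXn rmorphN1.
  rewrite mulrCA mul_polyC integral01Z -mulnn natrM -[in RHS]mulr_natr; ring.
rewrite (eq_bigr _ (fun i _ => E i)) -mulr_sumr -exprDn subrr expr0n.
by rewrite (gtn_eqF d0) mulr0.
Qed.

(** The coefficient of degree d is the sum of the squares of the binomials, which is positive. *)
Lemma size_legendre d : size (legendre d) = d.+1.
Proof.
have sz i : (i <= d)%N -> size ('X ^+ (d - i) * ('X - 1) ^+ i : {poly R})%R = d.+1.
  move=> id; rewrite size_Mmonic ?monic_exp ?monicXsubC ?expf_neq0 ?polyX_eq0//.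
  by rewrite size_polyXn -polyC1 size_exp_XsubC addnS /= addSn subnK.
have cf i : (i <= d)%N -> ('X ^+ (d - i) * ('X - 1) ^+ i : {poly R})`_d = 1.
  move=> id; have /monicP : ('X ^+ (d - i) * ('X - 1) ^+ i : {poly R}) \is monic.
    by rewrite rpredM ?monic_exp ?monicX// -polyC1 monicXsubC.
  by rewrite lead_coefE sz.
have up : (size (legendre d) <= d.+1)%N.
  apply/(leq_trans (size_sum _ _ _))/bigmax_leqP => i _.
  by rewrite (leq_trans (size_scale_leq _ _))// sz ?leq_ord.
apply/eqP; rewrite eqn_leq up ltnNge; apply/negP => /leq_sizeP/(_ d (leqnn _)).
rewrite coef_sum; apply/eqP; rewrite gt_eqF// big_ord_recl.
rewrite coefZ cf// mulr1 bin0 ltr_pwDl// sumr_ge0// => i _.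
by rewrite coefZ cf ?mulr1 ?ler0n// -[(_ <= d)%N]/(lift ord0 i < d.+1)%N.
Qed.

(** * Averages of polynomials over finite families of points *)

Section Averages.
Variables (n : nat -> nat) (p : nat -> nat -> R).
Hypothesis n_gt0 : forall k, (0 < n k)%N.

Definition avg k f := (n k)%:R^-1 * \sum_(j < n k) f.[p k j].

Lemma avgD k f g : avg k (f + g) = avg k f + avg k g.
Proof.
rewrite /avg -mulrDr -big_split; congr (_ * _).
by apply: eq_bigr => j _; rewrite hornerD.
Qed.

Lemma avgZ k c f : avg k (c *: f) = c * avg k f.
Proof.
rewrite /avg mulrCA; congr (_ * _); rewrite mulr_sumr.
by apply: eq_bigr => j _; rewrite hornerZ.
Qed.

Lemma avg1 k : avg k 1 = 1.
Proof.
rewrite /avg; under eq_bigr => j _ do rewrite hornerE.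
by rewrite sumr_const card_ord mulVf// pnatr_eq0 -lt0n.
Qed.

Hypothesis avg_legendre : forall d, (0 < d)%N -> null (fun k => avg k (legendre d)).

(** Induction on the size: subtracting a multiple of the Legendre polynomial of the same degree
    lowers it. *)
Lemma avg_cvg f : null (fun k => avg k f - integral01 f).
Proof.
have [m] := ubnP (size f); elim: m f => // m IH f; rewrite ltnS => sf.
case sfE : (size f) => [|d].
  move/eqP: sfE; rewrite size_poly_eq0 => /eqP->.
  by apply: eq_null (@null0 R) => k; rewrite -(scale0r 1) avgZ integral01Z !mul0r subrr.
have ld : lead_coef (legendre d) != 0 by rewrite lead_coef_eq0 -size_poly_eq0 size_legendre.
pose c := lead_coef f / lead_coef (legendre d).
pose g := f - c *: legendre d.
have fE : f = g + c *: legendre d by rewrite /g subrK.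
have sg : (size g < m)%N.
  apply: leq_trans sf; rewrite sfE ltnS; apply/leq_sizeP => j.
  rewrite leq_eqVlt => /predU1P[<-|dj].
    rewrite /g coefB coefZ; have := lead_coefE f; have := lead_coefE (legendre d).
    by rewrite size_legendre sfE/= => <- <-; rewrite divfK ?subrr.
  by rewrite /g coefB coefZ !nth_default ?mulr0 ?subrr// ?size_legendre ?sfE.
apply: (@eq_null _ (fun k => (avg k g - integral01 g) + c * (avg k (legendre d) - integral01 (legendre d)))).
  by move=> k; rewrite [in RHS]fE avgD integral01D avgZ integral01Z; ring.
apply: nullD; first exact: IH.
apply: nullZ; case: d {sfE ld c g fE sg} => [|d].
  apply: eq_null (@null0 R) => k.
  by rewrite /legendre big_ord1 bin0 !expr0 mulr1 !scale1r avg1 integral01_1 subrr.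
by apply: eq_null (avg_legendre (ltn0Sn d)) => k; rewrite integral01_legendre ?subr0.
Qed.

End Averages.

(** * Moments of the binomial distribution *)

Section Bernstein.
Variable x : R.

Let bsum N (g : nat -> R) := \sum_(i < N.+1) g i * (bernstein N i).[x].

Lemma bernsteinE N i : (bernstein N i).[x] = 'C(N, i)%:R * (x ^+ i * (1 - x) ^+ (N - i)).
Proof. by rewrite /bernstein !hornerE. Qed.

Lemma bsum1 N : bsum N (fun=> 1) = 1.
Proof.
rewrite /bsum -[RHS](hornerC 1 x) polyC1 -(sum_bernstein N) horner_sum.
by apply: eq_bigr => i _; rewrite mul1r.
Qed.

(** The absorption identity for binomials trades a factor i for a shift of index; applied repeatedly
    it yields the moments. *)
Lemma bsum_shift N (g : nat -> R) :
  bsum N.+1 (fun i => i%:R * g i) = N.+1%:R * x * bsum N (fun i => g i.+1).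
Proof.
rewrite /bsum big_ord_recl !mul0r add0r mulr_sumr; apply: eq_bigr => i _.
rewrite !bernsteinE lift0 subSS exprS.
have : N.+1%:R * 'C(N, i)%:R = i.+1%:R * 'C(N.+1, i.+1)%:R :> R.
  by rewrite -!natrM -mul_bin_diag.
move: (x ^+ i) ((1 - x) ^+ _) => a b e.
have -> : i.+1%:R * g i.+1 * ('C(N.+1, i.+1)%:R * (x * a * b)) =
  (i.+1%:R * 'C(N.+1, i.+1)%:R) * (g i.+1 * (x * a * b)) by ring.
by rewrite -e; ring.
Qed.

Lemma bernstein_variance N :
  \sum_(i < N.+2) (i%:R - N.+1%:R * x) ^+ 2 * (bernstein N.+1 i).[x] =
    N.+1%:R * (x * (1 - x)).
Proof.
have m1 M : bsum M.+1 (fun i => i%:R) = M.+1%:R * x.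
  have := bsum_shift M (fun=> 1); rewrite /= bsum1 mulr1 => <-.
  by apply: eq_bigr => i _; rewrite mulr1.
have m1' M : bsum M (fun i => i%:R) = M%:R * x.
  by case: M => [|M]; [rewrite /bsum big_ord1 !mul0r | exact: m1].
have m2 : bsum N.+1 (fun i => i%:R * i%:R) = N.+1%:R * x * (N%:R * x + 1).
  rewrite bsum_shift -(m1' N) -[X in _ + X](bsum1 N) /bsum -big_split/=; congr (_ * _).
  by apply: eq_bigr => i _; rewrite -natr1 mulrDl.
have -> : N.+1%:R * (x * (1 - x)) = bsum N.+1 (fun i => i%:R * i%:R)
   - 2 * (N.+1%:R * x) * bsum N.+1 (fun i => i%:R)
   + (N.+1%:R * x) ^+ 2 * bsum N.+1 (fun=> 1).
  by rewrite m2 m1 bsum1 -natr1; ring.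
rewrite /bsum !mulr_sumr -sumrB -big_split/=.
by apply: eq_bigr => i _; ring.
Qed.

End Bernstein.

End Moments.

(** * From polynomial averages to counting points in an interval *)

Section Counting.
Variable R : realType.

Lemma bernstein_ge0 (x : R) N i : 0 <= x <= 1 -> 0 <= (bernstein R N i).[x].
Proof.
move=> /andP[x0 x1]; rewrite bernsteinE mulr_ge0 ?ler0n// mulr_ge0 ?exprn_ge0//.
by rewrite subr_ge0.
Qed.

Lemma card_in_interval N (a b : R) (A : pred 'I_N) : 0 <= b - a ->
  (forall i : 'I_N, A i -> a <= i%:R <= b) -> #|A|%:R <= b - a + 1.
Proof.
move=> ab hA; case: (pickP A) => [i0 Ai0|A0]; last first.
  by rewrite eq_card0// ler_wpDr.
have [i1 Ai1 mx] := @arg_maxnP _ i0 A (fun i => i : nat) Ai0.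
have [i2 Ai2 mn] := @arg_minnP _ i0 A (fun i => i : nat) Ai0.
have le21 : (i2 <= i1)%N by apply: mx.
have cA : (#|A| <= i1 - i2 + 1)%N.
  have inj : {in A &, injective (fun i : 'I_N => inord (i - i2) : 'I_(i1 - i2).+1)}.
    move=> i j Ai Aj /(congr1 val) /= e.
    have := mx _ Ai; have := mx _ Aj; have := mn _ Ai; have := mn _ Aj => /= *.
    by apply/val_inj; move: e; rewrite /= !inordK; lia.
  by rewrite -(card_in_image inj) (leq_trans (max_card _))// card_ord addn1.
apply: le_trans (_ : (i1 - i2 + 1)%:R <= _); first by rewrite ler_nat.
rewrite natrD natrB// lerD2r.
by have /andP[_ h1] := hA _ Ai1; have /andP[h2 _] := hA _ Ai2; rewrite lerB.
Qed.

(** Chebyshev's inequality: outside [w] the deviation exceeds [dl], and the variance x (1 - x) / (N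
    + 1) is at most 1 / (N + 1). *)
Lemma bernstein_localize (x dl : R) N (w : pred 'I_N.+2) :
  0 <= x <= 1 -> 0 < dl ->
  (forall i : 'I_N.+2, `|i%:R / N.+1%:R - x| <= dl -> w i) ->
  1 <= (\sum_(i < N.+2 | w i) bernstein R N.+1 i).[x] + (N.+1%:R * dl ^+ 2)^-1.
Proof.
move=> x01 dl0 hw.
have n0 : 0 < N.+1%:R :> R by rewrite ltr0n.
have d2 : 0 < dl ^+ 2 by rewrite exprn_gt0.
apply: (@le_trans _ _ ((\sum_(i < N.+2 | w i) bernstein R N.+1 i).[x] +
    (N.+1%:R * dl) ^- 2 * (N.+1%:R * (x * (1 - x))))); last first.
  have -> : (N.+1%:R * dl) ^- 2 * (N.+1%:R * (x * (1 - x))) =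
      (N.+1%:R * dl ^+ 2)^-1 * (x * (1 - x)).
    by move: (N.+1%:R) n0 => n n0; field; rewrite !gt_eqF.
  rewrite lerD2l ler_piMr ?invr_ge0 ?mulr_ge0 ?ltW//.
  by move/andP: x01 => [? ?]; nra.
rewrite -bernstein_variance horner_sum mulr_sumr [X in X + _]big_mkcond -big_split/=.
rewrite -[leLHS](hornerC 1 x) polyC1 -(sum_bernstein R N.+1) horner_sum.
apply: ler_sum => i _; have b0 := bernstein_ge0 N.+1 i x01.
case: ifPn => [_|/negP nw].
  by rewrite lerDl mulr_ge0 ?invr_ge0 ?sqr_ge0// mulr_ge0 ?sqr_ge0.
rewrite add0r mulrA ler_peMl//.
have /ltW h : dl < `|i%:R / N.+1%:R - x|.
  by rewrite ltNge; apply/negP => /hw.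
rewrite mulrC ler_pdivlMr ?exprn_gt0 ?mulr_gt0// mul1r.
rewrite -[leRHS]real_normK ?num_real// ler_pXn2r ?nnegrE//; last by rewrite ltW ?mulr_gt0.
have -> : i%:R - N.+1%:R * x = N.+1%:R * (i%:R / N.+1%:R - x).
  by rewrite mulrBr mulrCA mulfV ?gt_eqF// mulr1.
by rewrite normrM (gtr0_norm n0) ler_pM2l.
Qed.

(** The test polynomial [S] sums the Bernstein polynomials whose nodes lie within [dl] of [a, b]. It
    is nonnegative on [0, 1], at least 1 - e/4 on [a, b], and of integral at most b - a + e/2;
    convergence of averages costs the last e/4. *)
Theorem equidistribution_upper (n : nat -> nat) (p : nat -> nat -> R) (a b e : R) :
  (forall k, (0 < n k)%N) ->
  (forall k j, (j < n k)%N -> 0 <= p k j <= 1) ->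
  (forall d, (0 < d)%N -> null (fun k => avg n p k (legendre R d))) ->
  a <= b -> 0 < e ->
  exists K, forall k, (K <= k)%N ->
    #|[pred j : 'I_(n k) | a <= p k j <= b]|%:R <= (b - a + e) * (n k)%:R.
Proof.
move=> n0 p01 hleg ab e0.
have [dl [dlE dl0]] : exists dl : R, dl = e / 8 /\ 0 < dl.
  by exists (e / 8); rewrite divr_gt0.
(* The first summand controls 1/(N + 2), the second the Chebyshev error; each becomes at most
   e/4. *)
pose B := 4 / e + 4 / e / dl ^+ 2.
have B0 : 0 <= B by rewrite addr_ge0 ?divr_ge0 ?exprn_ge0 ?ltW.
have [N hN] : exists N : nat, B <= N.+1%:R.
  by exists (Num.truncn B); rewrite ltW// truncnS_gt.
have N0 : 0 < N.+1%:R :> R by rewrite ltr0n.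
have hN1 : N.+2%:R^-1 <= e / 4.
  rewrite -[leRHS]invf_div lef_pV2 ?posrE ?divr_gt0//.
  apply: (@le_trans _ _ B); first by rewrite lerDl divr_ge0 ?exprn_ge0 ?divr_ge0 ?ltW.
  by rewrite (le_trans hN)// ler_nat.
have hN2 : (N.+1%:R * dl ^+ 2)^-1 <= e / 4.
  rewrite -[leRHS]invf_div lef_pV2 ?posrE ?divr_gt0 ?mulr_gt0 ?exprn_gt0//.
  rewrite -ler_pdivrMr ?exprn_gt0//; apply: le_trans hN.
  by rewrite lerDr divr_ge0 ?ltW.
pose w (i : 'I_N.+2) := a - dl <= i%:R / N.+1%:R <= b + dl.
pose S : {poly R} := \sum_(i < N.+2 | w i) bernstein R N.+1 i.
have lS : integral01 S <= b - a + e / 2.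
  rewrite /S integral01_sum (eq_bigr (fun=> N.+2%:R^-1)); last first.
    by move=> i _; rewrite integral01_bernstein ?leq_ord// -ltnS.
  rewrite sumr_const -[_ *+ #|_|]mulr_natl.
  have c : #|w|%:R <= N.+1%:R * (b + dl) - N.+1%:R * (a - dl) + 1.
    apply: card_in_interval; first by rewrite -mulrBr mulr_ge0 ?ler0n//; move: ab dl0; clear; lra.
    by move=> i /andP[h1 h2]; rewrite mulrC -ler_pdivlMr// h1 mulrC -ler_pdivrMr.
  apply: le_trans (_ : (b - a + 2 * dl) + N.+2%:R^-1 <= _); last first.
    by move: (N.+2%:R^-1) hN1 => y hy; lra.
  rewrite ler_pdivrMr ?ltr0n// mulrDl mulVf ?pnatr_eq0//.
  apply: (le_trans c); rewrite -[N.+2%:R]natr1.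
  by move: (N.+1%:R) N0 => y y0; nra.
have [K hK] := avg_cvg n0 hleg S (divr_gt0 e0 (ltr0Sn R 3)).
exists K => k /hK; rewrite ltr_norml => /andP[_ h].
have nk : 0 < (n k)%:R :> R by rewrite ltr0n.
apply: (@le_trans _ _ (\sum_(j < n k) (S.[p k j] + e / 4))).
  rewrite -sum1_card natr_sum big_mkcond/=; apply: ler_sum => j _.
  have x01 := p01 k j (ltn_ord j).
  have S0 : 0 <= S.[p k j].
    by rewrite horner_sum sumr_ge0// => i _; apply: bernstein_ge0.
  case: ifPn => [/andP[h1 h2]|_]; last by rewrite addr_ge0// divr_ge0// ltW.
  have loc (i : 'I_N.+2) : `|i%:R / N.+1%:R - p k j| <= dl -> w i.
    rewrite /w; move: (i%:R / N.+1%:R) (p k j) h1 h2 => y z h1 h2.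
    by rewrite ler_norml => /andP[h3 h4]; apply/andP; split; lra.
  apply: le_trans (bernstein_localize x01 dl0 loc) _.
  by rewrite lerD2l.
rewrite big_split/= sumr_const card_ord -[_ *+ n k]mulr_natr.
have -> : \sum_(j < n k) S.[p k j] = avg n p k S * (n k)%:R.
  by rewrite /avg mulrAC mulVf ?mul1r// gt_eqF.
rewrite -mulrDl ler_pM2r//.
by move: (avg n p k S) (integral01 S) h lS => y z h lS; lra.
Qed.

End Counting.

Lemma poly_ext (A : numDomainType) (p q : {poly A}) :
  (forall x, p.[x] = q.[x]) -> p = q.
Proof.
move=> pq; apply/eqP; rewrite -subr_eq0; apply/eqP.
apply: (@roots_geq_poly_eq0 _ _ [seq i%:R | i <- iota 0 (size (p - q))]).
- by apply/allP => x _; rewrite rootE hornerD hornerN pq subrr.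
- rewrite map_inj_uniq ?iota_uniq// => i j /eqP.
  by rewrite eqr_nat => /eqP.
- by rewrite size_map size_iota.
Qed.

Lemma big_ord_double (A : nmodType) n (F : nat -> A) :
  \sum_(j < n.*2) F j = \sum_(j < n) F j.*2 + \sum_(j < n) F j.*2.+1.
Proof.
elim: n => [|n IH]; first by rewrite !big_ord0 addr0.
by rewrite doubleS !big_ord_recr/= IH -!addrA; congr (_ + _); rewrite addrCA.
Qed.

(** * The Rudin-Shapiro recursion and the form Gamma_k *)

Section RudinShapiro.

(** The ring is arbitrary because the recursion is evaluated both at complex numbers and at ['X]. *)
Fixpoint rs (A : comNzRingType) k (z : A) : A * A :=
  if k is k'.+1 then
    let: (p, q) := rs k' z in (p + z ^+ (2 ^ k') * q, p - z ^+ (2 ^ k') * q)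
  else (1, 1).

Lemma rsS (A : comNzRingType) k (z : A) :
  rs k.+1 z = ((rs k z).1 + z ^+ (2 ^ k) * (rs k z).2,
               (rs k z).1 - z ^+ (2 ^ k) * (rs k z).2).
Proof. by rewrite /=; case: (rs k z). Qed.

Lemma rs_morph (A B : comNzRingType) (phi : {rmorphism A -> B}) k z :
  rs k (phi z) = (phi (rs k z).1, phi (rs k z).2).
Proof.
elim: k => [|k IH]; first by rewrite /= rmorph1.
by rewrite !rsS IH/= rmorphD rmorphB rmorphM rmorphXn.
Qed.

Variable C : numFieldType.
Implicit Types z s t : C.

(* On the unit circle [rs k z^-1] is the conjugate of [rs k z], so this is
   [|P_k(z)|^2 / 2^(k+1)]; the form below is polynomial in [z] and [z^-1]. *)
Definition rho k z := (rs k z).1 * (rs k z^-1).1 / 2 ^+ k.+1.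

Definition gamma_form k z s t :=
  (s * (rs k z).1 + t * (rs k z).2) *
  (t * (rs k z^-1).1 - s * (rs k z^-1).2) / 2 ^+ k.+1.

Let two0 : 2 != 0 :> C. Proof. by rewrite pnatr_eq0. Qed.

(** Parallelogram law: each step of the recursion doubles |P_k|^2 + |Q_k|^2. *)
Lemma rho_compl k z : z != 0 ->
  (rs k z).2 * (rs k z^-1).2 / 2 ^+ k.+1 = 1 - rho k z.
Proof.
move=> z0; rewrite /rho.
suff : (rs k z).1 * (rs k z^-1).1 + (rs k z).2 * (rs k z^-1).2 = 2 ^+ k.+1.
  move=> h; apply/eqP; rewrite eq_sym subr_eq addrC -mulrDl h mulfV//.
  by rewrite expf_neq0.
elim: k => [|k IH]; first by rewrite /= !mulr1 expr1.
rewrite !rsS exprVn [RHS]exprS -IH /=.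
have := expf_neq0 (2 ^ k) z0; move: (z ^+ _) => x x0; field.
by [].
Qed.

Lemma gamma_formS k z s t : z != 0 ->
  gamma_form k.+1 z s t =
    - (2 * z ^+ (2 ^ k))^-1 * gamma_form k z (s + t) (z ^+ (2 ^ k) * (s - t)).
Proof.
move=> z0; rewrite /gamma_form !rsS exprVn [2 ^+ k.+2]exprS /=.
have := expf_neq0 (2 ^ k) z0; move: (z ^+ _) => x x0.
have := expf_neq0 k.+1 two0; move: (2 ^+ k.+1) => y y0.
by field; rewrite x0 y0.
Qed.

(** With x = z^(2^k), two steps give P_{k+2} = (P_k + x Q_k) + x^2 (P_k - x Q_k), which is 2 P_k if
    x^2 = 1 and 2 x Q_k if x^2 = -1. *)
Lemma rhoSS k z : z != 0 -> z ^+ (2 ^ k) ^+ 4 = 1 ->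
  rho k.+2 z = if z ^+ (2 ^ k) ^+ 2 == 1 then rho k z else 1 - rho k z.
Proof.
move=> z0 z4; rewrite -(rho_compl k z0) /rho !rsS !exprVn /=.
rewrite expnS mulnC exprM [2 ^+ k.+3]exprS [2 ^+ k.+2]exprS.
have := expf_neq0 (2 ^ k) z0; move: (z ^+ _) z4 => x x4 x0.
have := expf_neq0 k.+1 two0; move: (2 ^+ k.+1) => y y0.
have x2 : (x ^+ 2 == 1) || (x ^+ 2 == -1).
  by rewrite -eqf_sqr expr1n -exprM x4.
case: ifPn => [/eqP xx|x1].
  by rewrite xx invr1; field; rewrite x0 y0.
move: x2; rewrite (negPf x1)/= => /eqP xx; rewrite xx invrN1.
have -> : x^-1 = - x.
  by apply: (mulfI x0); rewrite mulfV// mulrN -expr2 xx opprK.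
transitivity (- x ^+ 2 * ((rs k z).2 * (rs k z^-1).2) / y).
  by field; rewrite y0.
by rewrite xx opprK mul1r.
Qed.

(** * Averages of powers of Gamma_k over the 2^k-th roots of a point *)

Section Averaging.
Variables (R : realType) (phi : {rmorphism R -> C}) (pi : R) (e : R -> C).
Hypotheses (eD : forall x y, e (x + y) = e x * e y) (epi : e pi = -1).

Lemma e_neq0 x : e x != 0.
Proof.
apply/eqP => x0; have := eD x (pi - x); rewrite subrKC epi x0 mul0r => /eqP.
by rewrite oppr_eq0 oner_eq0.
Qed.

Lemma e0 : e 0 = 1.
Proof. by apply: (mulfI (e_neq0 0)); rewrite -eD addr0 mulr1. Qed.

Lemma eX x n : e (x *+ n) = e x ^+ n.
Proof. by elim: n => [|n IH]; rewrite ?e0 ?expr0// mulrS eD IH exprS. Qed.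

Lemma e2pi n : e (2 * pi * n%:R) = 1.
Proof.
by rewrite mulr_natr eX mulr_natl eX epi sqrrN !expr1n.
Qed.

Definition node k (th : R) j := e ((th + 2 * pi * j%:R) / 2 ^+ k).

Lemma node_neq0 k th j : node k th j != 0. Proof. exact: e_neq0. Qed.

Lemma nodeX k th j : node k th j ^+ (2 ^ k) = e th.
Proof.
rewrite /node -eX -[_ *+ (2 ^ k)]mulr_natr natrX divfK ?expf_neq0 ?pnatr_eq0//.
by rewrite eD e2pi mulr1.
Qed.

(** The roots at level k + 1 split into the level-k roots of the two square roots of [e th], which
    are opposite to each other. *)
Lemma node_double k th j :
  node k.+1 th j.*2 = node k (th / 2) j /\
  node k.+1 th j.*2.+1 = node k (th / 2 + pi) j.
Proof.
have two : 2 != 0 :> R by rewrite pnatr_eq0.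
rewrite /node exprS -natr1 -mul2n natrM.
have := expf_neq0 k two; move: (2 ^+ k) => y y0.
by split; congr e; field; rewrite y0.
Qed.

(** Adding the values at x and -x cancels the odd powers. *)
Lemma fold_sum N (a : 'M[R]_N.+1) (m : 'I_N.+1) x :
  2 * (\sum_(f < N.+1) (x ^+ 2) ^+ f * phi (fold_even a f m)) =
  \sum_(f < N.+1) (x ^+ (f + m) + (- x) ^+ (f + m)) * phi (a f m).
Proof.
rewrite mulr_sumr.
under eq_bigr => f _ do rewrite mxE rmorph_sum !mulr_sumr.
rewrite (exchange_big_dep xpredT)//=; apply: eq_bigr => g _.
rewrite exprNn -signr_odd; case: (boolP (odd (g + m))) => gm.
  by rewrite big_pred0 => [|f]; rewrite ?expr1 ?mulN1r ?subrr ?mul0r//; lia.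
have h : ((g + m)./2 < N.+1)%N by have := leq_ord g; have := leq_ord m; lia.
rewrite (big_pred1 (Ordinal h)) => [|f]; last by rewrite /= -val_eqE /=; lia.
by rewrite /= -exprM mul2n even_halfK// expr0 mul1r; ring.
Qed.

(** For k = 0 the form is -(s + t)(s - t)/2. Its d-th power is constant in w, hence sits in row d,
    which carries w^(f-d) for f = d. *)
Definition initial_state d : 'M[R]_(d.*2.+1) :=
  \matrix_(f, m) if f == d :> nat then scale_factor R d * krawtchouk R d.*2 (inord d) m else 0.

(** The factor [e th ^+ d] clears the negative powers of w. In the induction the nodes are split by
    square roots of w, [gamma_formS] changes the variables, and the sum over the two roots performs
    the fold. *)
Lemma average_gamma_form d k th s t :
  e th ^+ d * \sum_(j < 2 ^ k) gamma_form k (node k th j) s t ^+ d =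
  2 ^+ k * \sum_(f < d.*2.+1) e th ^+ f *
    \sum_(m < d.*2.+1) phi (iter k (@transfer R d) (initial_state d) f m) *
       (s ^+ (d.*2 - m) * t ^+ m).
Proof.
have phic : phi (scale_factor R d) = (- 2^-1) ^+ d.
  by rewrite rmorphXn rmorphN fmorphV rmorph_nat.
elim: k th s t => [|k IH] th s t.
  have hd : (d < d.*2.+1)%N by rewrite -addnn; lia.
  rewrite big_ord1 mul1r (bigD1 (Ordinal hd))//= [X in _ = _ + X]big1 ?addr0 => [|f].
    under eq_bigr => m _ do rewrite /initial_state mxE /= eqxx rmorphM -mulrA.
    rewrite -mulr_sumr krawtchouk_homog inordK// -addnn addnK; congr (_ * _).
    rewrite phic -!exprMn; congr (_ ^+ _).
    by rewrite /gamma_form /= !mulr1 expr1; field.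
  rewrite -val_eqE/= => fd; rewrite big1 ?mulr0// => m _.
  by rewrite /initial_state mxE (negPf fd) rmorph0 mul0r.
(* The contribution of one square root of [e th]. *)
have IHx th' : e th' ^+ 2 = e th ->
    e th ^+ d * \sum_(j < 2 ^ k) gamma_form k.+1 (node k th' j) s t ^+ d =
    (- 2^-1) ^+ d * 2 ^+ k *
    \sum_(m < d.*2.+1) (s + t) ^+ (d.*2 - m) * (s - t) ^+ m *
       \sum_(f < d.*2.+1) e th' ^+ (f + m) * phi (iter k (@transfer R d) (initial_state d) f m).
  move=> eth; have x0 := e_neq0 th'.
  under eq_bigr => j _ do rewrite gamma_formS ?node_neq0// nodeX exprMn.
  rewrite -mulr_sumr -eth mulrA -exprMn.
  have -> : e th' ^+ 2 * - (2 * e th')^-1 = - 2^-1 * e th' by field.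
  rewrite exprMn -[LHS]mulrA IH mulrA; congr (_ * _).
  under eq_bigr => f _ do rewrite mulr_sumr.
  rewrite exchange_big/=; apply: eq_bigr => m _; rewrite mulr_sumr.
  apply: eq_bigr => f _; rewrite exprMn exprD; ring.
rewrite expnS mul2n.
rewrite (big_ord_double _ (fun j => gamma_form k.+1 (node k.+1 th j) s t ^+ d)) mulrDr.
under eq_bigr => j _ do rewrite (node_double k th j).1.
under [X in _ + _ * X]eq_bigr => j _ do rewrite (node_double k th j).2.
have e2 : e (th / 2) ^+ 2 = e th by rewrite -eX -[_ *+ 2]mulr_natr divfK ?pnatr_eq0.
rewrite !IHx//; last by rewrite eD epi mulrN1 sqrrN.
set a := iter k (@transfer R d) (initial_state d).
have stepE f : \sum_(m < d.*2.+1) phi (iter k.+1 (@transfer R d) (initial_state d) f m) *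
      (s ^+ (d.*2 - m) * t ^+ m) =
    (- 2^-1) ^+ d * \sum_(m < d.*2.+1) phi (fold_even a f m) *
      ((s + t) ^+ (d.*2 - m) * (s - t) ^+ m).
  under [in RHS]eq_bigr => m _ do rewrite -(krawtchouk_homog phi) mulr_sumr.
  rewrite exchange_big mulr_sumr/=; apply: eq_bigr => m _.
  rewrite /transfer !mxE rmorphM rmorph_sum phic -mulrA; congr (_ * _).
  rewrite mulr_suml; apply: eq_bigr => i _; rewrite rmorphM.
  by rewrite -!mulrA.
under [in RHS]eq_bigr => f _ do rewrite stepE mulrCA mulr_sumr.
rewrite -mulr_sumr exchange_big/= [2 ^+ k.+1]exprS -mulrDr.
have -> S : 2 * 2 ^+ k * ((- 2^-1) ^+ d * S) = (- 2^-1) ^+ d * 2 ^+ k * (2 * S) :> C.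
  by ring.
congr (_ * _); rewrite mulr_sumr -big_split/=; apply: eq_bigr => m _.
rewrite -mulrDr -big_split/=.
transitivity ((s + t) ^+ (d.*2 - m) * (s - t) ^+ m *
    (2 * (\sum_(f < d.*2.+1) (e (th / 2) ^+ 2) ^+ f * phi (fold_even a f m)))).
  rewrite fold_sum; congr (_ * _); apply: eq_bigr => f _.
  by rewrite eD epi mulrN1 mulrDl.
rewrite e2 mulrCA; congr (_ * _); rewrite mulr_sumr.
by apply: eq_bigr => f _; ring.
Qed.

Definition gamma_poly k z : {poly C} :=
  ((rs k z).1%:P + (rs k z).2 *: 'X) *
  ((- (rs k z^-1).2)%:P + (rs k z^-1).1 *: 'X).

Lemma horner_gamma_poly k z t : (gamma_poly k z).[t] / 2 ^+ k.+1 = gamma_form k z 1 t.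
Proof. by rewrite /gamma_poly /gamma_form !hornerE; congr (_ / _); ring. Qed.

(** Pairing t^i from the first factor with t^(d-i) from the second gives binomial squares times
    powers of P P* = 2^(k+1) rho and -Q Q* = 2^(k+1) (rho - 1). *)
Lemma coef_gamma_poly d k z : z != 0 ->
  (gamma_poly k z ^+ d)`_d / (2 ^+ k.+1) ^+ d = (map_poly phi (legendre R d)).[rho k z].
Proof.
move=> z0; rewrite /gamma_poly exprMn coefM mulr_suml /legendre rmorph_sum horner_sum.
apply: eq_bigr => i _; rewrite !coef_expDZX subKn ?leq_ord// bin_sub ?leq_ord//.
rewrite /= map_polyZ rmorph_nat natrX [map_poly _ _]rmorphM !rmorphXn rmorphB rmorph1 /= map_polyX.
rewrite !hornerE.
have -> : rho k z - 1 = (rs k z).2 * - (rs k z^-1).2 / 2 ^+ k.+1.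
  by rewrite mulrN mulNr rho_compl// opprB.
have -> : (2 ^+ k.+1) ^+ d = (2 ^+ k.+1) ^+ (d - i) * (2 ^+ k.+1) ^+ i :> C.
  by rewrite -exprD subnK ?leq_ord.
rewrite /rho !exprMn !exprVn.
have := expf_neq0 (d - i) (expf_neq0 k.+1 two0).
have := expf_neq0 i (expf_neq0 k.+1 two0).
move: ((2 ^+ k.+1) ^+ i) ((2 ^+ k.+1) ^+ (d - i)) => x y x0 y0.
by rewrite /=; field; rewrite x0 y0.
Qed.

(** At th = 0 all powers of w are 1, so the coefficient of t^d in the average is the sum of column d
    of the state, whose entries tend to 0. *)
Lemma avg_legendre_null (r : nat -> nat -> R) d :
  (forall k j, rho k (node k 0 j) = phi (r k j)) -> (0 < d)%N ->
  null (fun k => avg (expn 2) r k (legendre R d)).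
Proof.
move=> rhoE d0; have hd : (d < d.*2.+1)%N by rewrite -addnn; lia.
pose A k := iter k (@transfer R d) (initial_state d).
apply: (@eq_null _ (fun k => \sum_f A k f (Ordinal hd))); last first.
  by apply: null_sum => f _; apply: transfer_null.
move=> k; apply: (fmorph_inj phi).
have := @average_gamma_form d k 0 1 => E.
have {E} /(congr1 (fun p : {poly C} => p`_d)) :
    \sum_(j < 2 ^ k) (2 ^+ k.+1) ^- d *: gamma_poly k (node k 0 j) ^+ d =
    2 ^+ k *: \sum_f \sum_m phi (A k f m) *: 'X^m.
  apply: poly_ext => t; rewrite horner_sum hornerZ horner_sum.
  have := E t; rewrite e0 expr1n mul1r => E1.
  under eq_bigr => j _.
    rewrite hornerZ horner_exp mulrC -exprVn -exprMn horner_gamma_poly; over.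
  rewrite E1; congr (_ * _); apply: eq_bigr => f _.
  rewrite expr1n mul1r horner_sum; apply: eq_bigr => m _.
  by rewrite expr1n mul1r !hornerE.
rewrite coef_sum coefZ coef_sum => E.
rewrite /avg rmorphM fmorphV rmorph_nat natrX.
apply: (mulfI (expf_neq0 k two0)); rewrite mulrA mulfV ?expf_neq0// mul1r.
rewrite rmorph_sum; transitivity (2 ^+ k * \sum_f (\sum_m phi (A k f m) *: 'X^m)`_d).
  congr (_ * _); apply: eq_bigr => f _; rewrite coef_sum (bigD1 (Ordinal hd))//=.
  rewrite coefZ coefXn eqxx mulr1 big1 ?addr0// => m.
  by rewrite -val_eqE/= coefZ coefXn eq_sym => /negPf->; rewrite mulr0.
rewrite -E rmorph_sum; apply: eq_bigr => j _.
by rewrite coefZ mulrC coef_gamma_poly ?node_neq0// rhoE horner_map.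
Qed.

End Averaging.
End RudinShapiro.

(** * Bounding the number of zeros of X_k on the circle *)

Section Zeros.
Variable C : numFieldType.

(* The reciprocal polynomials [z^(2^k - 1) P_k(1/z)] and [z^(2^k - 1) Q_k(1/z)]. *)
Fixpoint rsr k : {poly C} * {poly C} :=
  if k is k'.+1 then
    let: (p, q) := rsr k' in ('X^(2 ^ k') * p + q, 'X^(2 ^ k') * p - q)
  else (1, 1).

Lemma rsrS k : rsr k.+1 = ('X^(2 ^ k) * (rsr k).1 + (rsr k).2,
                           'X^(2 ^ k) * (rsr k).1 - (rsr k).2).
Proof. by rewrite /=; case: (rsr k). Qed.

Lemma horner_rsr k (z : C) : z != 0 ->
  z * (rsr k).1.[z] = z ^+ (2 ^ k) * (rs k z^-1).1 /\
  z * (rsr k).2.[z] = z ^+ (2 ^ k) * (rs k z^-1).2.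
Proof.
move=> z0; elim: k => [|k [IH1 IH2]]; first by rewrite /= hornerC expr1.
rewrite rsrS rsS exprVn expnS mul2n -addnn exprD /= !hornerE.
have := expf_neq0 (2 ^ k) z0; move: (z ^+ _) IH1 IH2 => x IH1 IH2 x0.
split.
  rewrite mulrDr IH2 mulrCA IH1; by field.
rewrite mulrBr IH2 mulrCA IH1; by field.
Qed.

Lemma horner_rs k (z : C) : ((rs k 'X).1.[z], (rs k 'X).2.[z]) = rs k z.
Proof.
rewrite -[z in RHS](hornerX z).
by rewrite (rs_morph (horner_eval z : {rmorphism {poly C} -> C}) k 'X).
Qed.

(** For z != 0 and n = 2^k this is z^(n-1) (P_k(z) P_k(1/z) - n), which vanishes where rho = 1/2. *)
Definition zpoly k : {poly C} :=
  (rs k 'X).1 * (rsr k).1 - (2 ^+ k)%:P * 'X^((2 ^ k).-1).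

Lemma size_rs k : ((size (rs k 'X : {poly C} * {poly C}).1 <= 2 ^ k) /\
                   (size (rs k 'X : {poly C} * {poly C}).2 <= 2 ^ k) /\
                   (size (rsr k).1 <= 2 ^ k) /\ (size (rsr k).2 <= 2 ^ k))%N.
Proof.
elim: k => [|k [IH1 [IH2 [IH3 IH4]]]]; first by rewrite /= size_poly1.
have sh (p : {poly C}) : (size p <= 2 ^ k -> size ('X^(2 ^ k) * p)%R <= 2 ^ k.+1)%N.
  move=> sp; rewrite (leq_trans (size_polyMleq _ _))// size_polyXn expnS.
  by move: (size p) (2 ^ k)%N sp => *; lia.
have wd (p : {poly C}) : (size p <= 2 ^ k -> size p <= 2 ^ k.+1)%N.
  by move=> sp; rewrite (leq_trans sp)// leq_exp2l.
have ad (p q : {poly C}) : (size p <= 2 ^ k.+1 -> size q <= 2 ^ k.+1 ->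
    size (p + q)%R <= 2 ^ k.+1)%N.
  by move=> sp sq; rewrite (leq_trans (size_polyD _ _))// geq_max sp.
by rewrite rsS rsrS /=; do !split; apply: ad; rewrite ?size_polyN; auto.
Qed.

Lemma size_zpoly k : (size (zpoly k) <= 2 ^ k.+1)%N.
Proof.
have [s1 [_ [s2 _]]] := size_rs k; have k0 : (0 < 2 ^ k)%N by rewrite expn_gt0.
rewrite (leq_trans (size_polyD _ _))// geq_max size_polyN mul_polyC.
rewrite (leq_trans (size_polyMleq _ _))/= ?expnS; last first.
  by move: (size _) (size _) (2 ^ k)%N s1 s2 k0 => *; lia.
rewrite (leq_trans (size_scale_leq _ _))// size_polyXn.
by move: (2 ^ k)%N k0 => *; lia.
Qed.

(** For k > 0 the monomial vanishes at 0, while [rs] and [rsr] have nonzero constant terms. *)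
Lemma zpoly_neq0 k : (0 < k)%N -> zpoly k != 0.
Proof.
move=> k0; apply/eqP => /(congr1 (fun p => p.[0])).
have h0 j : ((0 : C) ^+ (2 ^ j)) = 0 by rewrite expr0n expn_eq0.
have e1 j : rs j (0 : C) = (1, 1).
  by elim: j => // j IH; rewrite rsS IH h0 /= mul0r addr0 subr0.
have e2 j : (rsr j).2.[0] != 0 /\ (rsr j).1.[0] != 0.
  elim: j => [|j [IH _]]; first by rewrite /= hornerC oner_eq0.
  by rewrite rsrS /= !hornerE h0 mul0r !add0r oppr_eq0.
have e3 : (rs k 'X).1.[0] = 1 :> C.
  by have := horner_rs k 0; rewrite e1; case.
have n1 : ((2 ^ k).-1 != 0)%N.
  by have := ltn_expl k (ltnSn 1); rewrite -lt0n; lia.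
rewrite /zpoly !hornerE e3 mul1r expr0n (negPf n1) mulr0 subr0 => /eqP.
by rewrite (negPf (e2 k).2).
Qed.

Lemma zpoly_root k z : z != 0 -> rho k z = 2^-1 -> root (zpoly k) z.
Proof.
move=> z0 h; rewrite rootE; apply/eqP/(mulfI z0); rewrite mulr0 /zpoly !hornerE.
have -> : (rs k 'X).1.[z] = (rs k z).1.
  by have := horner_rs k z; case: (rs k z) => ? ? [].
have [e1 _] := horner_rsr k z0.
have two0 : 2 != 0 :> C by rewrite pnatr_eq0.
have e2 : (rs k z).1 * (rs k z^-1).1 = 2 ^+ k.
  rewrite -[LHS](divfK (expf_neq0 k.+1 two0)) -/(rho k z) h.
  by rewrite [in LHS]exprS mulKf.
rewrite mulrBr mulrCA e1 mulrCA e2 mulrCA -exprS prednK ?expn_gt0//.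
by rewrite mulrC subrr.
Qed.

Lemma rho_half_zeros k (zs : seq C) : (0 < k)%N -> uniq zs ->
  (forall z, z \in zs -> z != 0 /\ rho k z = 2^-1) -> (size zs <= 2 ^ k.+1)%N.
Proof.
move=> k0 uz h; apply: leq_trans (size_zpoly k).
apply/ltnW/max_poly_roots; rewrite ?zpoly_neq0//.
by apply/allP => z /h [z0 hz]; apply: zpoly_root.
Qed.

End Zeros.

(** * Counting level crossings on a grid *)

Section Crossings.
Variable R : realType.

Definition ivt (g : R -> R) := forall a b y, a <= b ->
  (g a <= y <= g b) \/ (g b <= y <= g a) -> exists2 c, a <= c <= b & g c = y.

(** One point is chosen in each marked cell; half-open cells are disjoint, so the points are
    distinct. *)
Lemma select_points n (h : R) (P : R -> Prop) : 0 < h ->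
  exists2 s : seq R, uniq s /\ (forall x, x \in s -> 0 <= x < h * n%:R /\ P x) &
    size s = #|[pred j : 'I_n | `[< exists2 c, h * j%:R <= c < h * j.+1%:R & P c >]]|.
Proof.
move=> h0; set A := [pred j : 'I_n | _].
have ex (j : 'I_n) : {c : R | j \in A -> h * j%:R <= c < h * j.+1%:R /\ P c}.
  apply: cid; case: (boolP (j \in A)) => [/asboolP[c c1 c2]|_]; first by exists c.
  by exists 0.
pose c j := projT1 (ex j); have cP j : j \in A -> _ := projT2 (ex j).
exists [seq c j | j <- enum A]; last by rewrite size_map -cardE.
split=> [|x /mapP[j]]; last first.
  rewrite mem_enum => /cP[/andP[c1 c2] Pc] ->; split=> //.
  rewrite (le_trans _ c1) ?mulr_ge0 ?ler0n ?ltW//= (lt_le_trans c2)//.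
  by rewrite ler_pM2l// ler_nat.
rewrite map_inj_in_uniq ?enum_uniq// => i j; rewrite !mem_enum.
move=> /cP[/andP[i1 i2] _] /cP[/andP[j1 j2] _] eij; apply/val_inj => /=.
rewrite /c in eij; have := le_lt_trans i1 (_ : _ < h * j.+1%:R).
rewrite [projT1 _]eij => /(_ j2); have := le_lt_trans j1 (_ : _ < h * i.+1%:R).
rewrite -[projT1 _]eij => /(_ i2); rewrite !ltr_pM2l// !ltr_nat !ltnS => ? ?.
by apply/eqP; rewrite eqn_leq; apply/andP.
Qed.

(** Every cell contains a zero of f, contains a solution of g = eta, or has an end with g in
    [0, eta]. At most Z cells are of the first kind, and each bad node spoils at most two. *)
Lemma crossings n (h eta : R) (f g : R -> R) Z :
  0 < h -> 0 <= eta -> ivt f -> ivt g ->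
  (forall j, (j <= n)%N -> g (h * j%:R) = (-1) ^+ j * f (h * j%:R)) ->
  g (h * n%:R) = g 0 ->
  (forall s : seq R, uniq s -> (forall x, x \in s -> 0 <= x < h * n%:R /\ f x = 0) ->
     (size s <= Z)%N) ->
  exists2 s : seq R, uniq s /\ (forall x, x \in s -> 0 <= x < h * n%:R /\ g x = eta) &
    (n <= size s + Z + 2 * #|[pred j : 'I_n | (0 <= g (h * j%:R) <= eta)%R]|)%N.
Proof.
move=> h0 eta0 cf cg gf gper hZ.
have [s1 [u1 p1] sz1] := @select_points n h (fun x => f x = 0) h0.
have [s2 [u2 p2] sz2] := @select_points n h (fun x => g x = eta) h0.
exists s2 => //; have := hZ s1 u1 p1; rewrite sz1 sz2 => le1.
pose b j : bool := 0 <= g (h * j%:R) <= eta.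
(* Periodicity makes bad right ends as numerous as bad left ends. *)
have cB : (\sum_(j < n) b j.+1 = \sum_(j < n) b j)%N.
  apply/eqP; rewrite -(eqn_add2l (b 0%N)) addnC.
  have -> : (\sum_(j < n) b j.+1 + b 0%N = \sum_(j < n.+1) b j)%N.
    by rewrite big_ord_recl addnC.
  by rewrite big_ord_recr /= addnC /b gper mulr0.
set A1 := [pred j : 'I_n | _] in le1; set A2 := [pred j : 'I_n | _] in sz2 *.
have key (j : 'I_n) : [|| j \in A1, j \in A2, b j | b j.+1].
  case: (boolP (b j)) => [|nb]; first by rewrite !orbT.
  case: (boolP (b j.+1)) => [|nb1]; first by rewrite !orbT.
  case: (boolP (j \in A1)) => //= /asboolP nz; rewrite !orbF; apply/asboolP.
  have jj : h * j%:R < h * j.+1%:R by rewrite ltr_pM2l// ltr_nat.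
  have fz x : h * j%:R <= x < h * j.+1%:R -> f x != 0.
    by move=> hx; apply/eqP => fx; apply: nz; exists x.
  have g1 : g (h * j.+1%:R) != 0.
    by apply: contraNneq nb1 => e; rewrite /b e lexx.
  have f1 : f (h * j.+1%:R) != 0.
    by apply: contraNneq g1 => e; rewrite gf// e mulr0.
  have fz' x : h * j%:R <= x <= h * j.+1%:R -> f x != 0.
    move=> /andP[x1]; rewrite le_eqVlt => /predU1P[->//|x2].
    by apply: fz; rewrite x1.
  have fpos : 0 < f (h * j%:R) * f (h * j.+1%:R).
    have ff : f (h * j%:R) * f (h * j.+1%:R) != 0.
      by rewrite mulf_neq0// fz'// lexx ltW.
    rewrite lt_neqAle eq_sym ff leNgt; apply/negP => neg.
    have [c hc /eqP] : exists2 c, h * j%:R <= c <= h * j.+1%:R & f c = 0.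
      apply: cf (ltW jj) _; move: neg; move: (f (h * j%:R)) (f (h * j.+1%:R)) => x y neg.
      case: (lerP x 0) => x0; [left|right]; rewrite ?x0 ?(ltW x0) ?andbT /= leNgt;
        apply/negP => y0; move: neg; rewrite ltNge.
        by rewrite (mulr_le0 x0 (ltW y0)).
      by rewrite (ltW (mulr_gt0 x0 y0)).
    by apply/negP/fz'.
  have gneg : g (h * j%:R) * g (h * j.+1%:R) < 0.
    rewrite !gf ?(ltnW (ltn_ord j))// mulrACA -exprD addnS addnn.
    by rewrite -signr_odd /= odd_double expr1 mulN1r oppr_lt0.
  (* Opposite signs outside [0, eta] put one end below 0 and the other above eta. *)
  have [c /andP[c1 c2] gc] :
      exists2 c, h * j%:R <= c <= h * j.+1%:R & g c = eta.
    apply: cg (ltW jj) _; move: nb nb1 gneg; rewrite /b !negb_and -!ltNge.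
    move: (g (h * j%:R)) (g (h * j.+1%:R)) => x y /orP[x0|x0] /orP[y0|y0] neg.
    - by exfalso; nra.
    - by left; apply/andP; split; lra.
    - by right; apply/andP; split; lra.
    - by exfalso; nra.
  (* The solution is not the right end, which would then be bad; so it lies in the half-open
     cell. *)
  exists c => //; rewrite c1 lt_neqAle c2 andbT; apply/eqP => e.
  by move: nb1; rewrite /b -e gc eta0 lexx.
have bE : #|[pred j : 'I_n | 0 <= g (h * j%:R) <= eta]| = (\sum_(j < n) b j)%N.
  by rewrite -sum1_card big_mkcond.
rewrite bE mul2n -addnn -[X in (_ + (X + _))%N]cB.
have {}le1 : (\sum_(j < n) (j \in A1) <= Z)%N.
  by apply: leq_trans le1; rewrite -sum1_card [leqRHS]big_mkcond.
have -> : #|A2| = (\sum_(j < n) (j \in A2))%N by rewrite -sum1_card big_mkcond.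
apply: leq_trans (_ : (\sum_(j < n) ((j \in A2) + (j \in A1) + (b j.+1 + b j))) <= _)%N.
  rewrite -[leqLHS]card_ord -sum1_card; apply: leq_sum => j _.
  by have := key j; case: (j \in A1) (j \in A2) (b j) (b j.+1) => [] [] [] [].
by rewrite !big_split/= !leq_add2r leq_add2l.
Qed.

End Crossings.

(** * The unit circle through real sine and cosine *)

Local Open Scope complex_scope.

#[local] Arguments cos : clear scopes.
#[local] Arguments sin : clear scopes.
#[local] Arguments Rk : clear scopes.
#[local] Bind Scope ring_scope with R.

Local Notation C := (R[i]).

Definition cis (t : R) : C := cos t +i* sin t.

Lemma cisD (x y : R) : cis (x + y) = cis x * cis y.
Proof.
rewrite /cis cosD sinD; apply/eqP; rewrite eq_complex /= eqxx /=.
by apply/eqP; ring.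
Qed.

Lemma cis_PI : cis PI = -1.
Proof. by rewrite /cis cos_PI sin_PI; apply/eqP; rewrite eq_complex /= oppr0 !eqxx. Qed.

Lemma cis_conj t : cis t * (cis t)^* = 1.
Proof.
apply/eqP; rewrite eq_complex /=; apply/andP; split; apply/eqP; last by ring.
by have := sin2_cos2 t; rewrite /Rsqr RplusE !RmultE => h; rewrite -[RHS]h; ring.
Qed.

Lemma cis_inv t : (cis t)^-1 = (cis t)^*.
Proof.
by apply: (mulfI (e_neq0 cisD cis_PI t)); rewrite cis_conj mulfV ?(e_neq0 cisD cis_PI).
Qed.

(** Equal values force cos(y - x) = 1, against cos(y - x) = 1 - 2 sin^2((y - x)/2) with (y - x)/2
    strictly between 0 and pi. *)
Lemma cis_inj (x y : R) : 0 <= x < 2 * PI -> 0 <= y < 2 * PI -> cis x = cis y -> x = y.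
Proof.
wlog lt : x y / x < y.
  move=> W hx hy; case: (ltgtP x y) => // lt h; first exact: W.
  by apply/esym/W.
move=> /andP[x0 _] /andP[_ y1] e; exfalso.
have s0 : 0 < sin ((y - x) / 2).
  have h0 : 0 < (y - x) / 2 by rewrite divr_gt0 ?subr_gt0.
  have h1 : (y - x) / 2 < PI.
    by rewrite ltr_pdivrMr// mulrC ltrBlDr (lt_le_trans y1)// lerDl.
  by apply/RltP/sin_gt_0; apply/RltP.
have c1 : cos (y - x) = 1.
  have := cis_conj x; rewrite {1}e => /eqP; rewrite eq_complex /= => /andP[/eqP <- _].
  have -> : cos (y - x) = cos (- x + y) by rewrite addrC.
  by rewrite cosD cos_neg sin_neg RoppE; ring.
have := cos_2a_sin ((y - x) / 2).
have -> : Rmult 2 ((y - x) / 2) = y - x by rewrite RmultE mulrC divfK// pnatr_eq0.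
rewrite c1; move: (sin _) s0 => s s0; rewrite !(RminusE, RmultE).
rewrite (_ : IZR 2 = 2)// (_ : IZR 1 = 1)// => h.
have h2 : 0 < 2 * s * s by rewrite !mulr_gt0.
by move: h; lra.
Qed.

(** * Coefficient lists as values of the polynomials *)

Definition ev (l : list R) j t : C := re_eval l j t +i* im_eval l j t.

Lemma ev_cons a l j t : ev (a :: l) j t = a%:C * cis t ^+ j + ev l j.+1 t.
Proof.
have -> : cis t ^+ j = cis (INR j * t).
  by rewrite INRE mulr_natl (eX cisD cis_PI).
by apply/eqP; rewrite eq_complex /= !RplusE !RmultE !mul0r subr0 addr0 !eqxx.
Qed.

Lemma ev_nil j t : ev nil j t = 0. Proof. by []. Qed.

Lemma ev_app l1 l2 j t :
  ev (List.app l1 l2) j t = ev l1 j t + ev l2 (j + length l1) t.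
Proof.
elim: l1 j => [|a l IH] j; first by rewrite /= addn0 ev_nil add0r.
by rewrite /= !ev_cons IH addrA addnS addSn.
Qed.

Lemma ev_opp l j t : ev (List.map Ropp l) j t = - ev l j t.
Proof.
elim: l j => [|a l IH] j; first by rewrite /= ev_nil oppr0.
by rewrite /= !ev_cons IH RoppE rmorphN opprD mulNr.
Qed.

Lemma ev_shift l j m t : ev l (m + j) t = cis t ^+ m * ev l j t.
Proof.
elim: l j => [|a l IH] j; first by rewrite !ev_nil mulr0.
by rewrite !ev_cons -addnS IH exprD; ring.
Qed.

Lemma RS_succ k : RS k.+1 =
  (List.app (RS_P k) (RS_Q k), List.app (RS_P k) (List.map Ropp (RS_Q k))).
Proof. by rewrite /RS_P /RS_Q /=; case: (RS k). Qed.

Lemma length_RS k : length (RS_P k) = (2 ^ k)%N /\ length (RS_Q k) = (2 ^ k)%N.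
Proof.
elim: k => // k [IH1 IH2]; rewrite /RS_P /RS_Q RS_succ /=.
by rewrite !List.length_app List.length_map IH1 IH2 expnS mul2n -addnn.
Qed.

Lemma ev_RS k t : (ev (RS_P k) 0 t, ev (RS_Q k) 0 t) = rs k (cis t).
Proof.
elim: k => [|k IH].
  by rewrite /RS_P /RS_Q /= ev_cons ev_nil expr0 mulr1 addr0.
rewrite rsS -IH /RS_P /RS_Q RS_succ /= !ev_app ev_opp (length_RS k).1.
by rewrite -[(0 + _)%N]addn0 ev_shift.
Qed.

Lemma abs2E l t : (abs2_on_circle l t)%:C = ev l 0 t * (ev l 0 t)^*.
Proof.
apply/eqP; rewrite eq_complex /= /abs2_on_circle RplusE !RpowE.
by apply/andP; split; apply/eqP; ring.
Qed.

Lemma rs_conj k t : rs k (cis t)^-1 = ((rs k (cis t)).1^*, (rs k (cis t)).2^*).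
Proof. by rewrite cis_inv (rs_morph (@conjc R : {rmorphism C -> C})). Qed.

(** This is (1 + X_k)/2, so X_k = 0 is the level 1/2; by [ratio_compl] it covers Q_k as well. *)
Definition ratio k t : R := Rk true k t / 2 ^+ k.+1.

Lemma ratioE k t : rho k (cis t) = (ratio k t)%:C.
Proof.
rewrite /rho rs_conj /ratio rmorphM fmorphV rmorphXn rmorph_nat /Rk /= abs2E.
by have := ev_RS k t; case: (rs k (cis t)) => p q [-> _].
Qed.

Lemma ratio_compl k t : 1 - ratio k t = Rk false k t / 2 ^+ k.+1.
Proof.
apply: (@complexI R); rewrite rmorphB rmorph1 /= -ratioE.
rewrite -rho_compl ?(e_neq0 cisD cis_PI)// rs_conj.
rewrite rmorphM fmorphV rmorphXn rmorph_nat /Rk /= abs2E.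
by have := ev_RS k t; case: (rs k (cis t)) => p q [_ ->].
Qed.

Lemma Rk_ge0 b k t : 0 <= Rk b k t.
Proof. by rewrite /Rk /abs2_on_circle RplusE !RpowE addr_ge0 ?sqr_ge0. Qed.

Lemma ratio_itv k t : 0 <= ratio k t <= 1.
Proof.
apply/andP; split; first by rewrite divr_ge0 ?Rk_ge0 ?exprn_ge0.
by rewrite -subr_ge0 ratio_compl divr_ge0 ?Rk_ge0 ?exprn_ge0.
Qed.

(** * Continuity, oscillation at the nodes, and zeros *)

Lemma continuity_eval l j : continuity (re_eval l j) /\ continuity (im_eval l j).
Proof.
elim: l j => [|a l IH] j /=.
  by split; apply: continuity_const => x y.
have [IH1 IH2] := IH j.+1.
have lin : continuity (fun t => Rmult (INR j) t).
  by apply: continuity_mult; [apply: continuity_const => x y | exact: derivable_continuous derivable_id].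
split; apply: continuity_plus => //; apply: continuity_scal.
  exact: (continuity_comp _ _ lin continuity_cos).
exact: (continuity_comp _ _ lin continuity_sin).
Qed.

Lemma continuity_ratio k : continuity (ratio k).
Proof.
have [h1 h2] := continuity_eval (RS_P k) 0.
have h : continuity (Rk true k).
  have sq (u : R -> R) : continuity u -> continuity (fun t => pow (u t) 2).
    by move=> cu; rewrite /=; do 2?apply: continuity_mult => //; apply: continuity_const => x y.
  exact: continuity_plus (sq _ h1) (sq _ h2).
by apply: continuity_mult => //; apply: continuity_const => x y.
Qed.

Lemma continuity_ivt (g : R -> R) : continuity g -> ivt g.
Proof.
move=> cg a b y ab h.
have cgy : continuity (fun x => Rminus (g x) y).
  by apply: continuity_minus => //; apply: continuity_const => u v.
have [|c [[/RleP ac /RleP cb] gc]] := IVT_cor _ a b cgy (elimT RleP ab).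
  apply/RleP; change ((g a - y) * (g b - y) <= 0).
  by case: h => /andP[h1 h2]; [apply: mulr_le0_ge0|apply: mulr_ge0_le0];
    rewrite ?subr_le0 ?subr_ge0.
exists c; first by rewrite ac.
by apply/eqP; rewrite -subr_eq0; apply/eqP.
Qed.

(** At this node z^(2^k) = i^j, whose square (-1)^j selects the case of [rhoSS]. *)
Lemma ratio_nodes k j :
  ratio k.+2 (2 * PI / 2 ^+ k.+2 * j%:R) - 2^-1 =
  (-1) ^+ j * (ratio k (2 * PI / 2 ^+ k.+2 * j%:R) - 2^-1).
Proof.
set t := 2 * PI / _ * _; have z0 := e_neq0 cisD cis_PI t.
have z1 : (cis t ^+ (2 ^ k)) ^+ 2 = (-1) ^+ j.
  rewrite -exprM -(eX cisD cis_PI) -cis_PI -(eX cisD cis_PI); congr cis.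
  rewrite -[t *+ _]mulr_natr -[PI *+ _]mulr_natr natrM natrX /t !exprS.
  have := expf_neq0 k (_ : 2 != 0 :> R); rewrite pnatr_eq0 => /(_ isT).
  by move: (2 ^+ k) => y y0; field.
have z4 : (cis t ^+ (2 ^ k)) ^+ 4 = 1.
  by rewrite (exprM _ 2 2) z1 -exprM mulnC exprM sqrrN !expr1n.
have := rhoSS z0 z4; rewrite z1 !ratioE -(signr_odd C) -(signr_odd R).
case: (odd j) => /=; last first.
  by rewrite expr0 eqxx mul1r => /complexI->.
have -> : ((-1) ^+ 1 == 1 :> C) = false.
  by rewrite expr1 -subr_eq0 -opprD oppr_eq0 -[1 + 1]/(2%:R) pnatr_eq0.
rewrite expr1 mulN1r -(rmorph1 (real_complex R)) -rmorphB => /complexI->.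
by field.
Qed.

Lemma ratio_zeros k (s : seq R) : (0 < k)%N -> uniq s ->
  (forall x, x \in s -> 0 <= x < 2 * PI /\ ratio k x = 2^-1) -> (size s <= 2 ^ k.+1)%N.
Proof.
move=> k0 us hs; rewrite -(size_map cis).
apply: (@rho_half_zeros C) => // [|_ /mapP[x /hs [_ rx] ->]].
  rewrite map_inj_in_uniq// => x y /hs[hx _] /hs[hy _]; exact: cis_inj.
split; first exact: (e_neq0 cisD cis_PI).
by rewrite ratioE rx fmorphV rmorph_nat.
Qed.

Lemma PI_gt0 : 0 < PI. Proof. exact/RltP/PI_RGT_0. Qed.

Lemma ratio_2PI k : ratio k (2 * PI) = ratio k 0.
Proof.
apply: (@complexI R); rewrite -!ratioE (e0 cisD cis_PI).
by have := e2pi cisD cis_PI 1; rewrite mulr1 => ->.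
Qed.

(** * Equidistribution and the count of solutions *)

Lemma ratio_equidistribution (a b e : R) : a <= b -> 0 < e ->
  exists K, forall k, (K <= k)%N ->
    #|[pred j : 'I_(2 ^ k) | a <= ratio k (2 * PI / 2 ^+ k * j%:R) <= b]|%:R
      <= (b - a + e) * 2 ^+ k.
Proof.
move=> ab e0.
pose p k j := ratio k (2 * PI / 2 ^+ k * j%:R).
have [||d d0|K hK] := @equidistribution_upper R (expn 2) p a b e _ _ _ ab e0.
- by move=> k; rewrite expn_gt0.
- by move=> k j _; apply: ratio_itv.
- apply: (@avg_legendre_null C R (real_complex R) PI cis cisD cis_PI) => // k j.
  by rewrite /node add0r ratioE /p; congr (ratio k _)%:C; rewrite mulrAC.
by exists K => k /hK; rewrite natrX.
Qed.

Lemma solutions (sg eta eps : R) : sg = 1 \/ sg = -1 -> 0 <= eta < 2^-1 -> 0 < eps ->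
  exists K, forall k, (K <= k)%N -> exists2 s : seq R,
    uniq s /\ (forall x, x \in s -> 0 <= x < 2 * PI /\ sg * (2 * ratio k x - 1) = eta) &
    (2^-1 - eta - eps) * 2 ^+ k / 2 <= (size s)%:R.
Proof.
move=> hsg /andP[eta0 eta1] eps0.
(* X_k between 0 and eta, up to the sign [sg], confines [ratio] to an interval of length eta/2 with
   1/2 as an end. *)
have [[a b] /= ab hab] : exists2 ab : R * R, ab.2 - ab.1 = eta / 2 &
    forall x, 0 <= sg * (2 * x - 1) <= eta -> ab.1 <= x <= ab.2.
  case: hsg => ->.
    exists (2^-1, 2^-1 + eta / 2) => /= [|x /andP[x1 x2]]; first by ring.
    by apply/andP; split; lra.
  exists (2^-1 - eta / 2, 2^-1) => /= [|x /andP[x1 x2]]; first by ring.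
  by apply/andP; split; lra.
have [||K hK] := @ratio_equidistribution a b (eps / 4).
- by rewrite -subr_ge0 ab divr_ge0.
- by rewrite divr_gt0.
(* The bound 3 makes the index of the form k + 2 with k > 0, as [ratio_zeros] demands. *)
exists (maxn K 3) => k; rewrite geq_max => /andP[/hK {}hK k3].
case: k k3 hK => [|[|k]]// k3 hK.
have n0 : 0 < 2 ^+ k.+2 :> R by rewrite exprn_gt0.
pose h : R := 2 * PI / 2 ^+ k.+2.
have h0 : 0 < h by apply: divr_gt0 => //; apply: mulr_gt0; rewrite ?PI_gt0.
have hn : h * (2 ^ k.+2)%:R = 2 * PI by rewrite /h natrX divfK ?gt_eqF.
have cX m : ivt (fun x => sg * (2 * ratio m x - 1)).
  apply: continuity_ivt; apply: continuity_mult; first by apply: continuity_const => x y.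
  apply: continuity_minus; last by apply: continuity_const => x y.
  apply: continuity_mult; first by apply: continuity_const => x y.
  exact: continuity_ratio.
have sg0 : sg != 0 by case: hsg => ->; rewrite ?oppr_eq0 oner_eq0.
have [|||s [us hs] cs] := @crossings R (2 ^ k.+2) h eta
    (fun x => sg * (2 * ratio k x - 1)) (fun x => sg * (2 * ratio k.+2 x - 1))
    (2 ^ k.+1) h0 eta0 (cX k) (cX k.+2).
- move=> j _; have q (x : R) : 2 * x - 1 = 2 * (x - 2^-1) by field.
  by rewrite !q ratio_nodes; ring.
- by rewrite hn ratio_2PI.
- move=> s us hs; apply: ratio_zeros => // x /hs[]; rewrite hn => hx /eqP.
  rewrite mulf_eq0 (negPf sg0)/= subr_eq0 => /eqP e; split=> //.
  by lra.
exists s.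
  by split=> // x /hs; rewrite hn.
set B := #|_| in cs; set B' := #|_| in hK.
have BB : (B <= B')%N.
  by apply: subset_leq_card; apply/fintype.subsetP => j; rewrite !inE; apply: hab.
have {}cs : 2 ^+ k.+2 <= (size s)%:R + 2 ^+ k.+1 + 2 * B'%:R :> R.
  rewrite -!natrX -natrM -!natrD ler_nat (leq_trans cs)// leq_add2l leq_mul2l.
  by rewrite BB orbT.
(* With n = 2^(k+2) these give at least (1/2 - eta - eps/2) n solutions, which is above the claimed
   bound since eta < 1/2. *)
move: hK cs; rewrite ab [2 ^+ k.+2]exprS.
have : 0 < 2 ^+ k.+1 :> R by rewrite exprn_gt0.
move: (2 ^+ k.+1) (B'%:R) (size s)%:R => y u v y0 hK cs.
nra.
Qed.

(** * Passage to both polynomials, signed levels and standard lists *)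

Lemma In_mem (x : R) (s : seq R) : List.In x s <-> x \in s.
Proof.
elim: s => // y s IH; rewrite inE /=; split.
  by move=> [->|/IH ->]; rewrite ?eqxx ?orbT.
by move=> /predU1P[->|/IH]; [left | right].
Qed.

Lemma uniq_NoDup (s : seq R) : uniq s -> NoDup s.
Proof.
elim: s => [|x s IH] /=; first by constructor.
move=> /andP[xs us]; constructor; last exact: IH.
by move=> /In_mem xIn; rewrite xIn in xs.
Qed.

Lemma level_solutions (b : bool) (eta eps : R) :
  - 2^-1 < eta < 2^-1 -> 0 < eps ->
  exists K, forall k, (K <= k)%N -> exists2 s : seq R,
    uniq s /\ (forall t, t \in s -> 0 <= t < 2 * PI /\ Rk b k t = (1 + eta) * 2 ^+ k) &
    (2^-1 - `|eta| - eps) * 2 ^+ k / 2 <= (size s)%:R.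
Proof.
(* [x] is the level for X_k, reversed for Q_k because |Q_k|^2 = n (1 - X_k); [sg] then carries its
   sign. *)
move=> /andP[eta1 eta2] eps0; have [x xE] : exists x : R, x = if b then eta else - eta by eexists.
have [sg hsg sgE] : exists2 sg : R, sg = 1 \/ sg = -1 & sg * `|eta| = x.
  have ->: `|eta| = `|x| by case: (b) xE => ->; rewrite ?normrN.
  case: (ger0P x) => x0; first by exists 1; [left | rewrite mul1r].
  by exists (-1); [right | rewrite mulN1r opprK].
have eta_itv : 0 <= `|eta| < 2^-1 by rewrite normr_ge0 ltr_norml eta1.
have [K hK] := solutions hsg eta_itv eps0.
exists K => k /hK[s [us hs] cs]; exists s => //; split=> // t /hs[ht e]; split=> //.
have {}e : 2 * ratio k t - 1 = x.
  by rewrite -sgE -e mulrA; case: hsg => ->; rewrite ?mulr1 ?mulrNN ?mul1r.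
have n0 : 2 ^+ k.+1 != 0 :> R by rewrite expf_neq0 ?pnatr_eq0.
rewrite xE in e; case: (b) e => e.
  have -> : Rk true k t = ratio k t * 2 ^+ k.+1 by rewrite divfK.
  by rewrite -e exprS; ring.
have -> : Rk false k t = (1 - ratio k t) * 2 ^+ k.+1 by rewrite ratio_compl divfK.
have -> : eta = - (2 * ratio k t - 1) by rewrite e opprK.
by rewrite exprS; ring.
Qed.

Theorem level_lists (b : bool) (eta eps : R) :
  Rlt (Rdiv (-1) 2) eta /\ Rlt eta (Rdiv 1 2) -> Rlt 0 eps ->
  exists k0 : nat, forall k : nat, Peano.le k0 k ->
    exists ts : list R, NoDup ts /\
      (forall t, List.In t ts -> (Rle 0 t /\ Rlt t (Rmult 2 PI)) /\
         Rk b k t = Rmult (Rplus 1 eta) (pow 2 k)) /\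
      Rle (Rdiv (Rmult (Rminus (Rminus (Rdiv 1 2) (Rabs eta)) eps) (pow 2 k)) 2)
          (INR (length ts)).
Proof.
move=> [/RltP eta1 /RltP eta2] /RltP eps0.
have eta_itv : - 2^-1 < eta < 2^-1.
  by move: eta1 eta2; rewrite !RdivE mul1r mulN1r => -> ->.
have [K hK] := @level_solutions b eta eps eta_itv eps0.
exists K => k /ssrnat.leP /hK[s [us hs] cs]; exists s; split; first exact: uniq_NoDup.
split=> [t /In_mem /hs[/andP[/RleP t0 /RltP t1] e]|].
  by split; [split | rewrite e RpowE].
apply/RleP; rewrite !(RdivE, RmultE, RminusE, RabsE, RpowE, INRE) mul1r.
exact: cs.
Qed.

End RudinShapiroLevels.

Theorem theorem2p2 :
  forall (b : bool) (eta eps : R),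
    -1/2 < eta < 1/2 -> 0 < eps ->
    exists k0 : nat, forall k : nat, (k0 <= k)%nat ->
      exists ts : list R,
        NoDup ts /\
        (forall t, In t ts ->
           0 <= t < 2 * PI /\ Rk b k t = (1 + eta) * 2 ^ k) /\
        (1/2 - Rabs eta - eps) * 2 ^ k / 2 <= INR (length ts).
Proof. exact RudinShapiroLevels.level_lists. Qed.
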